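(* Let $R=\bigoplus_{n\in\mathbb{N}_0}R_n$ be a standard graded Noetherian ring whose base ring $(R_0,\mathfrak{m}_0)$ is local, and let $J_0\subseteq\mathfrak{m}_0$ be an ideal of $R_0$. Then the following statements are equivalent. (a) For every finitely generated graded $R$-module $M$ and every $i\in\mathbb{N}_0$, $H^{i}_{R_+,J_0R}(M)_n=0$ for all $n\gg 0$. (b) For every finitely generated graded $R$-module $M$, every $i\in\mathbb{N}_0$ and every $n\in\mathbb{Z}$, $H^{i}_{R_+,J_0R}(M)_n$ is a finitely generated $R_0$-module.
   Context: All rings are commutative Noetherian with identity. ''Standard graded'' means that $R=\bigoplus_{n\in\mathbb{N}_0}R_n$ is generated as an $R_0$-algebra by finitely many elements of $R_1$; $R_+:=\bigoplus_{n\geq 1}R_n$. For ideals $I,J$ of $R$ and an $R$-module $M$, the $(I,J)$-torsion submodule is $\Gamma_{I,J}(M):=\{x\in M: I^nx\subseteq Jx \text{ for } n\gg 1\}$ (equivalently, $I^n\subseteq \mathrm{Ann}(x)+J$ for some $n$), and $H^i_{I,J}(-)$ is the $i$-th right derived functor of $\Gamma_{I,J}(-)$. If $I,J$ are homogeneous and $M$ is graded, then $H^i_{I,J}(M)$ is a graded $R$-module: take a resolution of $M$ by injective objects in the category of graded $R$-modules and homogeneous (degree $0$) homomorphisms, apply $\Gamma_{I,J}$ and take cohomology. $H^i_{I,J}(M)_n$ denotes the component of degree $n$, an $R_0$-module. ''For all $n\gg0$'' means for all sufficiently large integers $n$ (the bound may depend on $M$ and $i$). *)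

(* Defs.v *)
From HB Require Import structures.
From mathcomp Require Import all_boot all_order all_algebra.
From mathcomp Require Import boolp classical_sets.
Set Implicit Arguments.
Unset Strict Implicit.
Unset Printing Implicit Defensive.
Import Order.TTheory GRing.Theory Num.Theory.
Local Open Scope ring_scope.
Local Open Scope classical_set_scope.

(** * Subrings and ideals

    Subsets are Prop-valued ([set R]).  [idealr_closed] of ring_quotient is not
    used because it only covers decidable proper ideals. *)

Definition add_subgroup (V : zmodType) (A : set V) : Prop :=
  A 0 /\ (forall x y, A x -> A y -> A (x - y)).

Definition subring (R : comNzRingType) (S : set R) : Prop :=
  [/\ add_subgroup S, S 1 & forall x y, S x -> S y -> S (x * y)].

(** [ideal_in S I]: [I] is an ideal of the ring [S], for [S] a subring of [R]. *)
Definition ideal_in (R : comNzRingType) (S I : set R) : Prop :=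
  [/\ I `<=` S, add_subgroup I & forall a x, S a -> I x -> I (a * x)].

Definition maximal_ideal_in (R : comNzRingType) (S m : set R) : Prop :=
  [/\ ideal_in S m, m <> S &
      forall I, ideal_in S I -> m `<=` I -> I = m \/ I = S].

(** [S] is a local ring and [m] is its maximal ideal. *)
Definition local_in (R : comNzRingType) (S m : set R) : Prop :=
  maximal_ideal_in S m /\ (forall m', maximal_ideal_in S m' -> m' = m).

Definition ideal_gen (R : comNzRingType) (A : set R) : set R :=
  smallest (ideal_in setT) A.

Definition noetherian (R : comNzRingType) : Prop :=
  forall I : set R, ideal_in setT I ->
    exists s : seq R, I = ideal_gen [set x | x \in s].

Definition ideal_mul (R : comNzRingType) (I J : set R) : set R :=
  ideal_gen [set x | exists a b, [/\ I a, J b & x = a * b]].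

Definition ideal_pow (R : comNzRingType) (I : set R) (n : nat) : set R :=
  iter n (ideal_mul I) setT.

(** * Gradings *)

(** [V] is the internal direct sum of its additive subgroups [C i]. *)
Definition is_direct_sum (V : zmodType) (K : eqType) (C : K -> set V) : Prop :=
  [/\ forall i, add_subgroup (C i),
      forall x, exists (s : seq K) (f : K -> V),
        [/\ uniq s, forall i, C i (f i) & x = \sum_(i <- s) f i]
    & forall (s : seq K) (f : K -> V),
        uniq s -> (forall i, C i (f i)) -> \sum_(i <- s) f i = 0 ->
        forall i, i \in s -> f i = 0].

Definition is_grading (R : comNzRingType) (G : nat -> set R) : Prop :=
  [/\ is_direct_sum G, G 0%N 1
    & forall m n x y, G m x -> G n y -> G (m + n)%N (x * y)].

Definition standard_graded (R : comNzRingType) (G : nat -> set R) : Prop :=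
  is_grading G /\
  exists s : seq R, (forall x, x \in s -> G 1%N x) /\
    smallest (@subring R) (G 0%N `|` [set x | x \in s]) = setT.

(** The ideal [R_+]. *)
Definition irrelevant (R : comNzRingType) (G : nat -> set R) : set R :=
  [set x | exists (N : nat) (f : nat -> R),
     (forall n, G n (f n)) /\ x = \sum_(1 <= n < N) f n].

(** Graded modules are graded by the integers. *)
Record gmod (R : comNzRingType) (G : nat -> set R) := GMod {
  gmod_sort :> lmodType R;
  gcomp : int -> set gmod_sort;
  gcomp_direct_sum : is_direct_sum gcomp;
  gcomp_scale : forall (m : nat) (n : int) (a : R) (x : gmod_sort),
    G m a -> gcomp n x -> gcomp (m%:Z + n) (a *: x) }.

Arguments gcomp {R G} M n : rename.

Definition homogeneous0 (R : comNzRingType) (G : nat -> set R) (A B : gmod G)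
    (f : A -> B) : Prop :=
  forall n x, gcomp A n x -> gcomp B n (f x).

(** * Finite generation

    [subquot_fg S Z B]: the [S]-module [Z / (Z `&` B)] is finitely generated,
    where [S] is a subring of [R] and [Z], [B] are [S]-submodules of [M]. *)
Definition subquot_fg (R : comNzRingType) (M : lmodType R)
    (S : set R) (Z B : set M) : Prop :=
  exists (k : nat) (g : 'I_k -> M), (forall j, Z (g j)) /\
    forall z, Z z -> exists c : 'I_k -> R,
      (forall j, S (c j)) /\ B (z - \sum_(j < k) c j *: g j).

Definition fin_gen (R : comNzRingType) (M : lmodType R) : Prop :=
  subquot_fg setT (setT : set M) [set 0].

(** * Local cohomology with respect to a pair of ideals *)

(** [Gamma_{I,J}(M)]. *)
Definition torsion (R : comNzRingType) (I J : set R) (M : lmodType R) : set M :=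
  [set x | exists n0 : nat, forall n, (n0 <= n)%N ->
     forall a, ideal_pow I n a -> exists2 b, J b & a *: x = b *: x].

(** Injective objects of the category of graded modules and homogeneous maps of
    degree 0; the monomorphisms of this category are the injective maps. *)
Definition graded_injective (R : comNzRingType) (G : nat -> set R)
    (E : gmod G) : Prop :=
  forall (A B : gmod G) (u : {linear A -> B}) (f : {linear A -> E}),
    homogeneous0 u -> injective u -> homogeneous0 f ->
    exists g : {linear B -> E}, homogeneous0 g /\ (forall x, g (u x) = f x).

Record graded_injective_resolution (R : comNzRingType) (G : nat -> set R)
    (M : gmod G) := GradedInjectiveResolution {
  res_obj : nat -> gmod G;
  res_aug : {linear M -> res_obj 0%N};
  res_diff : forall i, {linear res_obj i -> res_obj i.+1};
  res_obj_injective : forall i, graded_injective (res_obj i);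
  res_aug_homogeneous : homogeneous0 res_aug;
  res_diff_homogeneous : forall i, homogeneous0 (res_diff i);
  res_aug_inj : injective res_aug;
  res_exact0 : forall x, res_diff 0%N x = 0 <-> exists y, x = res_aug y;
  res_exactS : forall i x,
    res_diff i.+1 x = 0 <-> exists y, x = res_diff i y }.

Section LocalCohomology.
Variables (R : comNzRingType) (G : nat -> set R) (I J : set R) (M : gmod G).

(** Cocycles and coboundaries of the complex [Gamma_{I,J}(E)]. *)
Definition lc_cocycles (E : graded_injective_resolution M) (i : nat) :
    set (res_obj E i) :=
  [set x | torsion I J x /\ res_diff E i x = 0].

Definition lc_coboundaries (E : graded_injective_resolution M) (i : nat) :
    set (res_obj E i) :=
  match i return set (res_obj E i) with
  | 0%N => [set 0]
  | j.+1 => [set x | exists2 y, torsion I J y & x = res_diff E j y]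
  end.

Arguments lc_cocycles : clear implicits.
Arguments lc_coboundaries : clear implicits.

(** [H^i_{I,J}(M)_n] is the subquotient
    [(lc_cocycles E i)_n / (lc_coboundaries E i)_n].  As it does not depend,
    up to isomorphism, on the graded injective resolution [E], its properties
    are required for every [E]. *)
Definition lc_vanishes (i : nat) (n : int) : Prop :=
  forall E : graded_injective_resolution M,
    lc_cocycles E i `&` gcomp (res_obj E i) n `<=`
    lc_coboundaries E i `&` gcomp (res_obj E i) n.

(** Finite generation of [H^i_{I,J}(M)_n] over the base ring [R_0 = G 0]. *)
Definition lc_fin_gen (i : nat) (n : int) : Prop :=
  forall E : graded_injective_resolution M,
    subquot_fg (G 0%N) (lc_cocycles E i `&` gcomp (res_obj E i) n)
      (lc_coboundaries E i `&` gcomp (res_obj E i) n).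

End LocalCohomology.

Arguments lc_cocycles {R G} I J {M} E i.
Arguments lc_coboundaries {R G} I J {M} E i.

(* Main.v *)
Require Import Defs.
From HB Require Import structures.
From mathcomp Require Import all_boot all_order all_algebra.
From mathcomp Require Import boolp classical_sets.
From mathcomp Require Import ring.
Set Implicit Arguments.
Unset Strict Implicit.
Unset Printing Implicit Defensive.
Import Order.TTheory GRing.Theory Num.Theory.
Local Open Scope ring_scope.
Local Open Scope classical_set_scope.

(** Both implications are proved by devissage along sequences
    [0 -> K -> M -> M/K -> 0], where [K] is the torsion of [M] with respect to a
    single homogeneous element [y], so that [y] is nilpotent on [K] and regular
    on [N = M/K]; the quotient [Q = N/yN] is again killed by [y], and
    [H^{i-1}(Q) -> H^i(N)(-d) -> H^i(N) -> H^i(Q)], with [d] the degree of [y]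
    and multiplication by [y] in the middle, is exact.

    If all generators [y] of [R_+] are nilpotent on [M], then [M] is bounded
    above, hence has a resolution by graded injectives bounded above, which are
    torsion; so [H^i(M) = 0] for [i > 0] and [H^0(M) = M].

    (a) => (b): with [y] of degree 1, [H^i(N)_n] is an extension of a submodule
    of [H^i(N)_{n+1}] by a quotient of [H^{i-1}(Q)_{n+1}], and one descends from
    the degrees where [H^i(N)] vanishes.

    (b) => (a): with [y] in [J_0], multiplication by [y] is onto on [H^i(N)_n]
    for large [n], which is therefore zero by Nakayama.  This reduces to modules
    on which [J_0] is nilpotent; there every cohomology class is killed by a
    power of each [y] in [R_1], while [y] is injective on [H^i(N)_n] for large
    [n]. *)

(** * Submodules and quotients of modules *)

(** The statement quantifies over all graded injective resolutions, and a devissage step involves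
    three modules with unrelated ones. Exactness is therefore proved for arbitrary resolutions: the
    mapping cocone of a lift [EM -> EN] of a surjection with kernel [K] is again a resolution of [K]
    by graded injectives, and comparing it with [EK] up to homotopy gives the exact sequence. Of the
    torsion functor this uses only that linear maps preserve torsion and that torsion elements form
    a homogeneous submodule; homogeneity is the delicate point, since the relation [y^e x = b x]
    need not pass to components with the same [e].

    The splitting into [K] and [N] is what makes [N(-d) -> N -> Q] short exact. When [J_0] is
    nilpotent on a module, a cocycle [z], being torsion, satisfies [y^e z = b z] with [b] in [J],
    and a power of [b] kills its class; hence so does a power of [y]. Nakayama applies degree by
    degree because elements of [J_0] have degree 0 and lie in the maximal ideal of [R_0]. Injectives
    bounded above are coinduced from copies of Q/Z placed only in the degrees where the module is
    nonzero. *)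

Section AddSubgroup.
Variables (V : zmodType) (A : set V).
Hypothesis hA : add_subgroup A.

Lemma asub0 : A 0. Proof. by case: hA. Qed.
Lemma asubB x y : A x -> A y -> A (x - y). Proof. by case: hA => _; apply. Qed.
Lemma asubN x : A x -> A (- x).
Proof. by move=> Ax; rewrite -sub0r; apply: asubB => //; exact: asub0. Qed.
Lemma asubD x y : A x -> A y -> A (x + y).
Proof. by move=> Ax Ay; rewrite -(opprK y); apply: asubB => //; apply: asubN. Qed.
Lemma asub_sum (K : Type) (r : seq K) (P : pred K) (F : K -> V) :
  (forall k, P k -> A (F k)) -> A (\sum_(k <- r | P k) F k).
Proof. by move=> AF; apply: big_ind => //; [exact: asub0 | exact: asubD]. Qed.
Lemma asub_sum_seq (K : eqType) (r : seq K) (F : K -> V) :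
  (forall k, k \in r -> A (F k)) -> A (\sum_(k <- r) F k).
Proof. by move=> AF; rewrite big_seq; apply: asub_sum. Qed.
End AddSubgroup.

(** The scalars range over a subset [S] because graded components are modules over [G 0] only. *)
Definition submod (R : comNzRingType) (V : lmodType R) (S : set R) (W : set V) :=
  add_subgroup W /\ forall a x, S a -> W x -> W (a *: x).

Section Submod.
Variables (R : comNzRingType) (V : lmodType R) (S : set R) (W : set V).
Hypothesis hW : submod S W.
Lemma submod_sub : add_subgroup W. Proof. by case: hW. Qed.
Lemma submod0 : W 0. Proof. exact: asub0 submod_sub. Qed.
Lemma submodB x y : W x -> W y -> W (x - y). Proof. exact: asubB submod_sub _ _. Qed.
Lemma submodN x : W x -> W (- x). Proof. exact: asubN submod_sub _. Qed.
Lemma submodD x y : W x -> W y -> W (x + y). Proof. exact: asubD submod_sub _ _. Qed.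
Lemma submodZ a x : S a -> W x -> W (a *: x). Proof. by case: hW => _; apply. Qed.
End Submod.

Lemma linear_mk (R : comNzRingType) (A B : lmodType R) (f : A -> B) :
  (forall a x y, f (a *: x + y) = a *: f x + f y) ->
  exists g : {linear A -> B}, forall x, g x = f x.
Proof.
move=> lf.
pose m := GRing.isLinear.Build R A B *:%R f lf.
pose g : {linear A -> B} := HB.pack f m.
by exists g.
Qed.

Section SubLmodule.
Variables (R : comNzRingType) (V : lmodType R) (W : set V).

Record sublmod (hW : submod setT W) := SubLmod { sublmod_val : V; sublmodP : W sublmod_val }.

Variable hW : submod setT W.
Local Notation T := (sublmod hW).

Lemma sublmod_inj : injective (@sublmod_val hW).
Proof.
by move=> [x hx] [y hy] /= exy; subst y; rewrite (Prop_irrelevance hx hy).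
Qed.

HB.instance Definition _ := gen_eqMixin T.
HB.instance Definition _ := gen_choiceMixin T.

Let zero : T := SubLmod hW (submod0 hW).
Let opp (x : T) : T := SubLmod hW (submodN hW (sublmodP x)).
Let add (x y : T) : T := SubLmod hW (submodD hW (sublmodP x) (sublmodP y)).
Let scale (a : R) (x : T) : T := SubLmod hW (submodZ hW (a := a) I (sublmodP x)).

Let addA : associative add.
Proof. by move=> x y z; apply: sublmod_inj => /=; rewrite addrA. Qed.
Let addC : commutative add.
Proof. by move=> x y; apply: sublmod_inj => /=; rewrite addrC. Qed.
Let add0 : left_id zero add.
Proof. by move=> x; apply: sublmod_inj => /=; rewrite add0r. Qed.
Let addN : left_inverse zero opp add.
Proof. by move=> x; apply: sublmod_inj => /=; rewrite addNr. Qed.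

HB.instance Definition _ := GRing.isZmodule.Build T addA addC add0 addN.

Let scaleA a b v : scale a (scale b v) = scale (a * b) v.
Proof. by apply: sublmod_inj => /=; rewrite scalerA. Qed.
Let scale1 : left_id 1 scale.
Proof. by move=> x; apply: sublmod_inj => /=; rewrite scale1r. Qed.
Let scaleDr : right_distributive scale +%R.
Proof. by move=> a x y; apply: sublmod_inj => /=; rewrite scalerDr. Qed.
Let scaleDl v : {morph scale^~ v : a b / a + b}.
Proof. by move=> a b; apply: sublmod_inj => /=; rewrite scalerDl. Qed.

HB.instance Definition _ := GRing.Zmodule_isLmodule.Build R T scaleA scale1 scaleDr scaleDl.

Let val_lin : linear (@sublmod_val hW). Proof. by []. Qed.
HB.instance Definition _ := GRing.isLinear.Build R T V *:%R (@sublmod_val hW) val_lin.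

End SubLmodule.

Section QuotLmodule.
Variables (R : comNzRingType) (V : lmodType R) (W : set V).

(** [xget] depends only on the set it chooses from, so congruent elements get the same
    representative; the quotient is then the set of these representatives. *)
Definition coset_rep (x : V) : V := xget 0 [set y | W (x - y)].

Record quotlmod (hW : submod setT W) :=
  QuotLmod { quotlmod_rep : V; quotlmodP : exists x, quotlmod_rep = coset_rep x }.

Variable hW : submod setT W.
Local Notation T := (quotlmod hW).

Definition quot_proj (x : V) : T := @QuotLmod hW (coset_rep x) (ex_intro _ x erefl).

Lemma quotlmod_inj : injective (@quotlmod_rep hW).
Proof.
by move=> [x hx] [y hy] /= exy; subst y; rewrite (Prop_irrelevance hx hy).
Qed.

Lemma coset_repP x : W (x - coset_rep x).
Proof.
rewrite /coset_rep; case: xgetP => [y _ //|/(_ x)]; case.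
by rewrite /= subrr; exact: (submod0 hW).
Qed.

Lemma quot_projP x y : (quot_proj x = quot_proj y) <-> W (x - y).
Proof.
split=> [[exy]|Wxy].
  have := submodB hW (coset_repP x) (coset_repP y).
  by rewrite exy opprB addrA subrK.
apply: quotlmod_inj => /=; rewrite /coset_rep; congr xget.
apply/seteqP; split => z /= Wz.
  by have := submodB hW Wz Wxy; rewrite opprB addrC addrA subrK.
by have := submodD hW Wxy Wz; rewrite addrA subrK.
Qed.

Lemma quot_proj_rep (q : T) : quot_proj (quotlmod_rep q) = q.
Proof.
case: q => [r [x ex]] /=; apply: quotlmod_inj => /=; subst r.
have /esym := congr1 (@quotlmod_rep hW) ((quot_projP x (coset_rep x)).2 (coset_repP x)).
by [].
Qed.

Lemma quot_proj_surj (q : T) : exists x, q = quot_proj x.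
Proof. by exists (quotlmod_rep q); rewrite quot_proj_rep. Qed.

HB.instance Definition _ := gen_eqMixin T.
HB.instance Definition _ := gen_choiceMixin T.

Local Notation p := quot_proj.
Let zero : T := p 0.
Let opp (x : T) : T := p (- quotlmod_rep x).
Let add (x y : T) : T := p (quotlmod_rep x + quotlmod_rep y).
Let scale (a : R) (x : T) : T := p (a *: quotlmod_rep x).

Let rep_sub x : W (quotlmod_rep (p x) - x).
Proof. by apply/quot_projP; rewrite quot_proj_rep. Qed.
Let pD x y : add (p x) (p y) = p (x + y).
Proof.
apply/quot_projP; have := submodD hW (rep_sub x) (rep_sub y).
by rewrite addrACA -opprD.
Qed.
Let pN x : opp (p x) = p (- x).
Proof. by apply/quot_projP; have := submodN hW (rep_sub x); rewrite opprD. Qed.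
Let pZ a x : scale a (p x) = p (a *: x).
Proof.
by apply/quot_projP; have := submodZ hW (a := a) I (rep_sub x); rewrite scalerBr.
Qed.

Let addA : associative add.
Proof.
move=> x y z; have [x' ->] := quot_proj_surj x; have [y' ->] := quot_proj_surj y.
by have [z' ->] := quot_proj_surj z; rewrite !pD addrA.
Qed.
Let addC : commutative add.
Proof.
move=> x y; have [x' ->] := quot_proj_surj x; have [y' ->] := quot_proj_surj y.
by rewrite !pD addrC.
Qed.
Let add0 : left_id zero add.
Proof. by move=> x; have [x' ->] := quot_proj_surj x; rewrite pD add0r. Qed.
Let addN : left_inverse zero opp add.
Proof. by move=> x; have [x' ->] := quot_proj_surj x; rewrite pN pD addNr. Qed.

HB.instance Definition _ := GRing.isZmodule.Build T addA addC add0 addN.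

Let scaleA a b v : scale a (scale b v) = scale (a * b) v.
Proof. by have [x ->] := quot_proj_surj v; rewrite !pZ scalerA. Qed.
Let scale1 : left_id 1 scale.
Proof. by move=> v; have [x ->] := quot_proj_surj v; rewrite !pZ scale1r. Qed.
Let scaleDr : right_distributive scale +%R.
Proof.
move=> a x y; have [x' ->] := quot_proj_surj x; have [y' ->] := quot_proj_surj y.
by rewrite /GRing.add /= pD !pZ pD scalerDr.
Qed.
Let scaleDl v : {morph scale^~ v : a b / a + b}.
Proof.
by move=> a b; have [x ->] := quot_proj_surj v; rewrite {2}/GRing.add /= !pZ pD scalerDl.
Qed.

HB.instance Definition _ := GRing.Zmodule_isLmodule.Build R T scaleA scale1 scaleDr scaleDl.

Let proj_lin : linear quot_proj.
Proof. by move=> a x y; rewrite -pD -pZ. Qed.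
HB.instance Definition _ := GRing.isLinear.Build R V T *:%R quot_proj proj_lin.

Lemma quot_proj_eq0 x : (quot_proj x = 0) <-> W x.
Proof.
by rewrite -(linear0 quot_proj); split=> [/quot_projP|Wx]; [|apply/quot_projP]; rewrite subr0.
Qed.

End QuotLmodule.

(** * Homogeneous components *)

Lemma sum_support (V : nmodType) (K : eqType) (g : K -> V) (t u : seq K) :
  uniq t -> uniq u -> {subset t <= u} -> (forall k, k \notin t -> g k = 0) ->
  \sum_(k <- u) g k = \sum_(k <- t) g k.
Proof.
move=> ut uu tu gt.
rewrite (bigID (mem t)) /= [X in _ + X]big1 ?addr0 => [|k]; last exact: gt.
rewrite -big_filter; apply: perm_big; apply: uniq_perm; rewrite ?filter_uniq // => k.
by rewrite mem_filter andb_idr //; exact: tu.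
Qed.

Section DirectSum.
Variables (V : zmodType) (K : eqType) (C : K -> set V).
Hypothesis dsC : is_direct_sum C.

Let dsC_sub k : add_subgroup (C k). Proof. by case: dsC. Qed.

(** The family given by [is_direct_sum] is arbitrary off [s]; setting it to 0 there makes it
    unique. *)
Let ds_ex x : exists f : K -> V, (forall k, C k (f k)) /\
  exists s : seq K, [/\ uniq s, (forall k, k \notin s -> f k = 0) & x = \sum_(k <- s) f k].
Proof.
have [_ /(_ x) [s [f [us fC ->]]] _] := dsC.
exists (fun k => if k \in s then f k else 0); split.
  by move=> k; case: ifP => _ //; exact: asub0.
exists s; split=> //; first by move=> k /negbTE ->.
by rewrite big_seq [RHS]big_seq; apply: eq_bigr => k ->.
Qed.

Definition ds_comp (x : V) : K -> V := sval (cid (ds_ex x)).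

Lemma ds_comp_in x k : C k (ds_comp x k).
Proof. by rewrite /ds_comp; case: cid => f [fC _] /=. Qed.

Lemma ds_comp_sum x : exists s : seq K,
  [/\ uniq s, (forall k, k \notin s -> ds_comp x k = 0) & x = \sum_(k <- s) ds_comp x k].
Proof. by rewrite /ds_comp; case: cid => f [fC [s hs]] /=; exists s. Qed.

Lemma ds_comp_uniq x (f : K -> V) (s : seq K) : (forall k, C k (f k)) -> uniq s ->
  (forall k, k \notin s -> f k = 0) -> x = \sum_(k <- s) f k -> ds_comp x =1 f.
Proof.
move=> fC us fs xf.
have [s' [us' fs' xf']] := ds_comp_sum x.
have [_ _ indep] := dsC.
pose u := undup (s ++ s').
have s_u : {subset s <= u} by move=> k ks; rewrite mem_undup mem_cat ks.
have s'_u : {subset s' <= u} by move=> k ks; rewrite mem_undup mem_cat ks orbT.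
have uu : uniq u by exact: undup_uniq.
have z : \sum_(k <- u) (ds_comp x k - f k) = 0.
  by rewrite sumrB (sum_support us' uu) // (sum_support us uu) // -xf -xf' subrr.
move=> k; have [ku|ku] := boolP (k \in u).
  apply/eqP; rewrite -subr_eq0; apply/eqP.
  apply: (indep u (fun k => ds_comp x k - f k)) => // l.
  by apply: asubB => //; apply: ds_comp_in.
rewrite fs' ?fs //; last by apply: contra ku; exact: s'_u.
by apply: contra ku; exact: s_u.
Qed.

Lemma ds_ind (P : V -> Prop) :
  (forall k x, C k x -> P x) -> (forall x y, P x -> P y -> P (x + y)) ->
  P 0 -> forall x, P x.
Proof.
move=> PC PD P0 x; have [s [_ _ ->]] := ds_comp_sum x.
by apply: big_ind => // k _; apply: (PC k); exact: ds_comp_in.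
Qed.

Lemma ds_comp_id k x : C k x -> ds_comp x k = x.
Proof.
move=> Cx; rewrite (@ds_comp_uniq x (fun l => if l == k then x else 0) [:: k]) ?eqxx //.
- by move=> l; case: eqP => [->|_] //; apply: asub0.
- by move=> l; rewrite inE => /negbTE ->.
- by rewrite big_seq1 eqxx.
Qed.

Lemma ds_comp_neq k l x : C k x -> l != k -> ds_comp x l = 0.
Proof.
move=> Cx lk; rewrite (@ds_comp_uniq x (fun l => if l == k then x else 0) [:: k]) ?(negbTE lk) //.
- by move=> l'; case: eqP => [->|_] //; apply: asub0.
- by move=> l'; rewrite inE => /negbTE ->.
- by rewrite big_seq1 eqxx.
Qed.

Lemma ds_comp0 k : ds_comp 0 k = 0.
Proof. by rewrite (@ds_comp_id k) //; exact: asub0. Qed.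

Lemma ds_compB x y k : ds_comp (x - y) k = ds_comp x k - ds_comp y k.
Proof.
have [s [us fs xs]] := ds_comp_sum x; have [t [ut ft yt]] := ds_comp_sum y.
pose u := undup (s ++ t).
have s_u : {subset s <= u} by move=> l ls; rewrite mem_undup mem_cat ls.
have t_u : {subset t <= u} by move=> l ls; rewrite mem_undup mem_cat ls orbT.
rewrite (@ds_comp_uniq (x - y) (fun k => ds_comp x k - ds_comp y k) u) ?undup_uniq //.
- by move=> l; apply: asubB => //; exact: ds_comp_in.
- move=> l lu; rewrite fs ?ft ?subr0 //; first by apply: contra lu; exact: t_u.
  by apply: contra lu; exact: s_u.
- by rewrite sumrB (sum_support us (undup_uniq _)) // (sum_support ut (undup_uniq _)) // -xs -yt.
Qed.

Lemma ds_compN x k : ds_comp (- x) k = - ds_comp x k.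
Proof. by rewrite -sub0r ds_compB ds_comp0 sub0r. Qed.

Lemma ds_compD x y k : ds_comp (x + y) k = ds_comp x k + ds_comp y k.
Proof. by rewrite -{1}(opprK y) ds_compB ds_compN opprK. Qed.

Lemma ds_comp_bigsum (L : Type) (r : seq L) (P : pred L) (F : L -> V) k :
  ds_comp (\sum_(l <- r | P l) F l) k = \sum_(l <- r | P l) ds_comp (F l) k.
Proof. by elim/big_rec2: _ => [|l y x _ <-]; rewrite ?ds_comp0 ?ds_compD. Qed.

Lemma ds_comp_inj x y : ds_comp x =1 ds_comp y -> x = y.
Proof.
move=> e; have [s [us fs xs]] := ds_comp_sum (x - y).
apply/eqP; rewrite -subr_eq0 xs; apply/eqP; apply: big1 => k _.
by rewrite ds_compB e subrr.
Qed.

End DirectSum.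

Definition gpart (R : comNzRingType) (G : nat -> set R) (M : gmod G) (x : M) (n : int) : M :=
  ds_comp (gcomp_direct_sum M) x n.

Definition bounded_above (R : comNzRingType) (G : nat -> set R) (M : gmod G) (c : int) :=
  forall n, c < n -> forall x, gcomp M n x -> x = 0.

Section Gpart.
Variables (R : comNzRingType) (G : nat -> set R).

Section One.
Variable M : gmod G.
Implicit Types (x y : M) (n : int).

Lemma gcomp_sub n : add_subgroup (gcomp M n).
Proof. by case: (gcomp_direct_sum M). Qed.
Lemma gcomp0 n : gcomp M n 0. Proof. exact: asub0 (gcomp_sub n). Qed.
Lemma gcompB n x y : gcomp M n x -> gcomp M n y -> gcomp M n (x - y).
Proof. exact: asubB (gcomp_sub n) _ _. Qed.
Lemma gcompZ0 n a x : G 0%N a -> gcomp M n x -> gcomp M n (a *: x).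
Proof. by move=> Ga Mx; have := gcomp_scale Ga Mx; rewrite add0r. Qed.

Lemma gpart_in x n : gcomp M n (gpart x n).
Proof. exact: ds_comp_in. Qed.
Lemma gpart_sum x : exists s : seq int, [/\ uniq s, (forall n, n \notin s -> gpart x n = 0)
  & x = \sum_(n <- s) gpart x n].
Proof. exact: ds_comp_sum. Qed.
Lemma gmod_ind (P : M -> Prop) : (forall n x, gcomp M n x -> P x) ->
  (forall x y, P x -> P y -> P (x + y)) -> P 0 -> forall x, P x.
Proof. exact: (ds_ind (gcomp_direct_sum M)). Qed.
Lemma gpart_id n x : gcomp M n x -> gpart x n = x.
Proof. exact: ds_comp_id. Qed.
Lemma gpart_neq n m x : gcomp M n x -> m != n -> gpart x m = 0.
Proof. exact: ds_comp_neq. Qed.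
Lemma gpart0 n : gpart (0 : M) n = 0. Proof. exact: ds_comp0. Qed.
Lemma gpartD x y n : gpart (x + y) n = gpart x n + gpart y n.
Proof. exact: ds_compD. Qed.
Lemma gpartB x y n : gpart (x - y) n = gpart x n - gpart y n.
Proof. exact: ds_compB. Qed.
Lemma gpart_bigsum (L : Type) (r : seq L) (P : pred L) (F : L -> M) n :
  gpart (\sum_(l <- r | P l) F l) n = \sum_(l <- r | P l) gpart (F l) n.
Proof. exact: ds_comp_bigsum. Qed.
Lemma gpart_inj x y : (forall n, gpart x n = gpart y n) -> x = y.
Proof. exact: ds_comp_inj. Qed.

Lemma gpartZ m a x n : G m a -> gpart (a *: x) (m%:Z + n) = a *: gpart x n.
Proof.
move=> Ga; move: x; apply: gmod_ind => [p x Mx|x y ex ey|].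
- have [->|np] := eqVneq n p.
    by rewrite !gpart_id //; exact: gcomp_scale.
  rewrite (gpart_neq Mx np) scaler0 (gpart_neq (gcomp_scale Ga Mx)) //.
  by rewrite (inj_eq (addrI _)).
- by rewrite scalerDr !gpartD ex ey scalerDr.
- by rewrite scaler0 !gpart0 scaler0.
Qed.

Lemma gpartZ' m a x n : G m a -> gpart (a *: x) n = a *: gpart x (n - m%:Z).
Proof. by move=> Ga; rewrite -(gpartZ x _ Ga) addrC subrK. Qed.

End One.

Lemma homogeneous0_gpart (A B : gmod G) (f : {linear A -> B}) x n :
  homogeneous0 f -> f (gpart x n) = gpart (f x) n.
Proof.
move=> hf; move: x; apply: gmod_ind => [p x Mx|x y ex ey|].
- have [->|np] := eqVneq n p.
    by rewrite !gpart_id //; exact: hf.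
  by rewrite (gpart_neq Mx np) linear0 (gpart_neq (hf _ _ Mx) np).
- by rewrite linearD !gpartD linearD ex ey.
- by rewrite linear0 !gpart0 linear0.
Qed.

Variable hG : is_grading G.
Let dsG : is_direct_sum G. Proof. by case: hG. Qed.

Definition rpart (a : R) (n : nat) : R := ds_comp dsG a n.

Lemma rpart_in a n : G n (rpart a n). Proof. exact: ds_comp_in. Qed.
Lemma grade_sub n : add_subgroup (G n). Proof. by case: dsG. Qed.
Lemma grade01 : G 0%N 1. Proof. by case: hG. Qed.
Lemma gradeM m n a b : G m a -> G n b -> G (m + n)%N (a * b).
Proof. by case: hG => _ _; apply. Qed.
Lemma gradeX m n a : G m a -> G (n * m)%N (a ^+ n).
Proof.
by move=> Ga; elim: n => [|n IH]; rewrite ?expr0 ?exprS ?mulSn; [exact: grade01|exact: gradeM].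
Qed.
Lemma rpartD a b n : rpart (a + b) n = rpart a n + rpart b n. Proof. exact: ds_compD. Qed.
Lemma rpartB a b n : rpart (a - b) n = rpart a n - rpart b n. Proof. exact: ds_compB. Qed.
Lemma rpart0 n : rpart 0 n = 0. Proof. exact: ds_comp0. Qed.
Lemma rpart_id n a : G n a -> rpart a n = a. Proof. exact: ds_comp_id. Qed.
Lemma rpart_neq n m a : G n a -> m != n -> rpart a m = 0. Proof. exact: ds_comp_neq. Qed.
Lemma ring_ind (P : R -> Prop) : (forall n x, G n x -> P x) ->
  (forall x y, P x -> P y -> P (x + y)) -> P 0 -> forall x, P x.
Proof. exact: (ds_ind dsG). Qed.
Lemma rpart_sum a : exists s : seq nat, [/\ uniq s, (forall n, n \notin s -> rpart a n = 0)
  & a = \sum_(n <- s) rpart a n].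
Proof. exact: ds_comp_sum. Qed.

(** There are no negative degrees, so the projection of [R] onto [R_0] is multiplicative. *)
Lemma rpartM0 a b : rpart (a * b) 0 = rpart a 0 * rpart b 0.
Proof.
move: a; apply: ring_ind => [m a Ga|a a' ea ea'|]; last 2 first.
- by rewrite mulrDl !rpartD ea ea' mulrDl.
- by rewrite mul0r !rpart0 mul0r.
move: b; apply: ring_ind => [n b Gb|b b' eb eb'|]; last 2 first.
- by rewrite mulrDr !rpartD eb eb' mulrDr.
- by rewrite mulr0 !rpart0 mulr0.
case: m Ga => [|m] Ga.
  case: n Gb => [|n] Gb; first by rewrite !rpart_id //; exact: (gradeM Ga Gb).
  by rewrite (rpart_neq (gradeM Ga Gb)) // (rpart_neq Gb) // mulr0.
by rewrite (rpart_neq (gradeM Ga Gb)) // (rpart_neq Ga) // mul0r.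
Qed.

(** Positive-degree parts of [a] would need components of [x] below [n]. Hence on the truncation of
    [M] to degrees at least [n], the projection to degree [n] is semilinear over [R -> R_0]. *)
Lemma gpart_lowest (M : gmod G) (a : R) (x : M) (n : int) :
  (forall k, k < n -> gpart x k = 0) -> gpart (a *: x) n = rpart a 0 *: gpart x n.
Proof.
move=> hx; move: a; apply: ring_ind => [m a Ga|a a' ea ea'|]; last 2 first.
- by rewrite scalerDl gpartD ea ea' rpartD scalerDl.
- by rewrite scale0r gpart0 rpart0 scale0r.
rewrite (gpartZ' _ _ Ga); case: m Ga => [|m] Ga; first by rewrite subr0 rpart_id.
by rewrite hx ?scaler0 ?(rpart_neq Ga) ?scale0r // ltrBlDr ltrDl.
Qed.

Lemma gpart_lower (M : gmod G) (a : R) (x : M) (n : int) :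
  (forall k, k < n -> gpart x k = 0) -> forall k, k < n -> gpart (a *: x) k = 0.
Proof.
move=> hx k kn; move: a; apply: ring_ind => [m a Ga|a a' ea ea'|]; last 2 first.
- by rewrite scalerDl gpartD ea ea' addr0.
- by rewrite scale0r gpart0.
by rewrite (gpartZ' _ _ Ga) hx ?scaler0 // (le_lt_trans _ kn) // lerBlDr lerDl.
Qed.

(** Extension of [rpart] by zero to negative degrees, so that a difference of two module degrees can
    be the index. *)
Definition rpartz (c : R) (d : int) : R := if d is Posz n then rpart c n else 0.

Lemma gpart_scale_hom (M : gmod G) (c : R) (x : M) p q : gcomp M p x ->
  gpart (c *: x) q = rpartz c (q - p) *: x.
Proof.
move=> Mx; move: c; apply: (ring_ind) => [m c Gc|c c' ec ec'|]; last 2 first.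
- rewrite scalerDl gpartD ec ec' -scalerDl; congr (_ *: _).
  by rewrite /rpartz; case: (q - p) => n; rewrite ?rpartD ?addr0.
- rewrite scale0r gpart0 /rpartz; case: (q - p) => n; by rewrite ?rpart0 scale0r.
rewrite (gpartZ' _ _ Gc).
have [e|ne] := eqVneq (q - m%:Z) p.
  have -> : q - p = m%:Z by rewrite -e opprB addrC subrK.
  by rewrite /rpartz rpart_id // e gpart_id.
rewrite (gpart_neq Mx ne) scaler0 /rpartz; case eqp: (q - p) => [n|n]; rewrite ?scale0r //.
have nm : n != m.
  by apply: contra ne => /eqP nm; rewrite -nm -eqp opprB addrC subrK.
by rewrite (rpart_neq Gc nm) scale0r.
Qed.

Lemma rpartzB c c' d : rpartz (c - c') d = rpartz c d - rpartz c' d.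
Proof. by case: d => n /=; rewrite ?rpartB ?subr0. Qed.

Lemma rpartzD c c' d : rpartz (c + c') d = rpartz c d + rpartz c' d.
Proof. by case: d => n /=; rewrite ?rpartD ?addr0. Qed.

Lemma rpartz0 d : rpartz 0 d = 0.
Proof. by case: d => n //=; rewrite rpart0. Qed.

Lemma rpartz_id c n : G n c -> rpartz c n%:Z = c.
Proof. exact: rpart_id. Qed.

Lemma rpartz_neq c n d : G n c -> d != n%:Z -> rpartz c d = 0.
Proof. by case: d => [m|//] Gc dn; exact: (rpart_neq Gc). Qed.

Lemma rpartzK c d d' : rpartz (rpartz c d) d' = if d' == d then rpartz c d else 0.
Proof.
case: d => [n|n] /=; last by case: ifP; case: d' => m; rewrite //= rpart0.
case: eqP => [->|/eqP nd]; first by rewrite /= rpart_id //; exact: rpart_in.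
by rewrite (rpartz_neq (rpart_in c n)).
Qed.

End Gpart.

(** * Constructions of graded modules *)

(** Every grading constructed below comes with explicit projections; orthogonal additive projections
    of finite support that separate points give a direct sum. *)
Lemma is_direct_sum_proj (V : zmodType) (K : eqType) (C : K -> set V) (p : K -> V -> V) :
  (forall k, add_subgroup (C k)) ->
  (forall k x, C k (p k x)) ->
  (forall k x y, p k (x - y) = p k x - p k y) ->
  (forall k x, C k x -> p k x = x) ->
  (forall k l x, C k x -> l != k -> p l x = 0) ->
  (forall x, exists s : seq K, forall k, k \notin s -> p k x = 0) ->
  (forall x, (forall k, p k x = 0) -> x = 0) ->
  is_direct_sum C.
Proof.
move=> subC pC pB pid pneq psupp pinj.
have p0 k : p k 0 = 0 by have := pB k 0 0; rewrite !subrr.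
have pD k x y : p k (x + y) = p k x + p k y.
  by rewrite -{1}(opprK y) -(sub0r y) !pB p0 sub0r opprK.
have psum k (r : seq K) f : p k (\sum_(i <- r) f i) = \sum_(i <- r) p k (f i).
  by elim/big_rec2: _ => [|i y x _ <-]; rewrite ?p0 ?pD.
have pcomp k (r : seq K) f : uniq r -> (forall i, C i (f i)) ->
    p k (\sum_(i <- r) f i) = if k \in r then f k else 0.
  move=> ur fC; rewrite psum; case: ifP => kr.
    rewrite (bigD1_seq k) //= pid // big1 ?addr0 // => i ik.
    by apply: (pneq i) => //; rewrite eq_sym.
  rewrite big_seq big1 // => i ir; apply: (pneq i) => //.
  by apply: contraFneq kr => ->.
split=> // [x|r f ur fC rf i ir].
  have [s hs] := psupp x; exists (undup s), (p^~ x); split; rewrite ?undup_uniq //.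
  apply/eqP; rewrite -subr_eq0; apply/eqP; apply: pinj => k.
  rewrite pB pcomp ?undup_uniq // mem_undup; case: ifP => [_|/negbT /hs ->]; exact: subrr.
by have := pcomp i r f ur fC; rewrite rf p0 ir => /esym.
Qed.

Section Constructions.
Variables (R : comNzRingType) (G : nat -> set R).

Lemma gpart_supp (M : gmod G) (x : M) :
  exists s : seq int, forall n, n \notin s -> gpart x n = 0.
Proof. by have [s [_ hs _]] := gpart_sum x; exists s. Qed.

Definition homogeneous_set (M : gmod G) (W : set M) : Prop :=
  forall x n, W x -> W (gpart x n).

Section Sub.
Variables (M : gmod G) (W : set M) (hW : submod setT W) (homW : homogeneous_set W).

Let sub_ds : is_direct_sum (fun n => [set w : sublmod hW | gcomp M n (sublmod_val w)]).
Proof.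
pose p n (w : sublmod hW) : sublmod hW := SubLmod hW (homW n (sublmodP w)).
apply: (@is_direct_sum_proj _ _ _ p) => /=.
- by move=> n; split=> [|x y] /=; [exact: gcomp0|exact: gcompB].
- by move=> n w; exact: gpart_in.
- by move=> n x y; apply: sublmod_inj; exact: gpartB.
- by move=> n w Mw; apply: sublmod_inj; exact: gpart_id.
- by move=> n m w Mw nm; apply: sublmod_inj; exact: (gpart_neq Mw).
- move=> w; have [s hs] := gpart_supp (sublmod_val w); exists s => n ns.
  by apply: sublmod_inj; exact: hs.
- move=> w wp; apply: sublmod_inj; apply: gpart_inj => n.
  by rewrite -[LHS]/(sublmod_val (p n w)) wp gpart0.
Qed.

Let sub_scale m n a (w : sublmod hW) :
  G m a -> gcomp M n (sublmod_val w) -> gcomp M (m%:Z + n) (sublmod_val (a *: w)).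
Proof. exact: gcomp_scale. Qed.

Definition subg : gmod G := GMod sub_ds sub_scale.
Definition subg_incl : {linear subg -> M} := @sublmod_val R M W hW.

Lemma subg_incl_hom : homogeneous0 subg_incl. Proof. by []. Qed.
Lemma subg_incl_inj : injective subg_incl. Proof. exact: sublmod_inj. Qed.
Lemma subg_inclP x : W x <-> exists y, x = subg_incl y.
Proof.
split=> [Wx|[y ->]]; last exact: sublmodP.
by exists (SubLmod hW Wx).
Qed.

End Sub.

Section Quot.
Variables (M : gmod G) (W : set M) (hW : submod setT W) (homW : homogeneous_set W).
Local Notation p := (@quot_proj R M W hW).

Let quot_ds : is_direct_sum (fun n => [set q : quotlmod hW | exists2 x, gcomp M n x & q = p x]).
Proof.
pose r n (q : quotlmod hW) : quotlmod hW := p (gpart (quotlmod_rep q) n).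
have rp n x : r n (p x) = p (gpart x n).
  apply/quot_projP; rewrite -gpartB; apply: homW.
  by apply/(quot_projP hW); rewrite quot_proj_rep.
apply: (@is_direct_sum_proj _ _ _ r) => /=.
- move=> n; split=> [|_ _ [x Mx ->] [y My ->]].
    by exists 0; [exact: gcomp0|rewrite linear0].
  by exists (x - y); [exact: gcompB|rewrite linearB].
- by move=> n q; exists (gpart (quotlmod_rep q) n) => //; exact: gpart_in.
- move=> n q q'; have [x ->] := quot_proj_surj q; have [y ->] := quot_proj_surj q'.
  by rewrite -linearB !rp gpartB linearB.
- by move=> n _ [x Mx ->]; rewrite rp gpart_id.
- by move=> n m _ [x Mx ->] nm; rewrite rp (gpart_neq Mx nm) linear0.
- move=> q; have [x ->] := quot_proj_surj q; have [s hs] := gpart_supp x; exists s => n ns.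
  by rewrite rp hs // linear0.
- move=> q; have [x ->] := quot_proj_surj q => hx; apply/(quot_proj_eq0 hW).
  have [s [_ _ ->]] := gpart_sum x; apply: asub_sum => [|n _]; first by case: hW.
  by apply/(quot_proj_eq0 hW); rewrite -rp.
Qed.

Let quot_scale m n a (q : quotlmod hW) : G m a -> (exists2 x, gcomp M n x & q = p x) ->
  exists2 x, gcomp M (m%:Z + n) x & a *: q = p x.
Proof.
by move=> Ga [x Mx ->]; exists (a *: x); [exact: gcomp_scale|rewrite linearZ].
Qed.

Definition quotg : gmod G := GMod quot_ds quot_scale.
Definition quotg_proj : {linear M -> quotg} := p.

Lemma quotg_proj_hom : homogeneous0 quotg_proj.
Proof. by move=> n x Mx; exists x. Qed.
Lemma quotg_proj_surj (q : quotg) : exists x, q = quotg_proj x.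
Proof. exact: quot_proj_surj. Qed.
Lemma quotg_proj_eq0 x : quotg_proj x = 0 <-> W x.
Proof. exact: quot_proj_eq0. Qed.

End Quot.

Section Prod.
Variables (A B : gmod G).

Let prod_ds : is_direct_sum (fun n => [set x : (A * B)%type | gcomp A n x.1 /\ gcomp B n x.2]).
Proof.
pose p n (x : (A * B)%type) : (A * B)%type := (gpart x.1 n, gpart x.2 n).
apply: (@is_direct_sum_proj _ _ _ p) => /=.
- by move=> n; split=> [|x y [? ?] [? ?]]; split=> /=; try exact: gcomp0; exact: gcompB.
- by move=> n x; split; exact: gpart_in.
- by move=> n x y; rewrite /p !gpartB.
- by move=> n [x y] [/= Ax By]; rewrite /p !gpart_id.
- by move=> n m [x y] [/= Ax By] nm; rewrite /p /= (gpart_neq Ax nm) (gpart_neq By nm).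
- move=> [x y]; have [s hs] := gpart_supp x; have [t ht] := gpart_supp y.
  exists (s ++ t) => n; rewrite mem_cat negb_or => /andP[ns nt].
  by rewrite /p /= hs ?ht.
- move=> [x y] xy; congr pair; apply: gpart_inj => n; rewrite gpart0.
    exact: (congr1 fst (xy n)).
  exact: (congr1 snd (xy n)).
Qed.

Let prod_scale m n a (x : (A * B)%type) : G m a -> gcomp A n x.1 /\ gcomp B n x.2 ->
  gcomp A (m%:Z + n) (a *: x).1 /\ gcomp B (m%:Z + n) (a *: x).2.
Proof. by move=> Ga [? ?]; split; exact: gcomp_scale. Qed.

Definition prodg : gmod G := GMod prod_ds prod_scale.
End Prod.

Section Shift.
Variables (M : gmod G) (d : int).

Let shift_ds : is_direct_sum (fun n => gcomp M (n + d)).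
Proof.
apply: (@is_direct_sum_proj _ _ _ (fun n x => gpart x (n + d))) => /=.
- by move=> n; exact: gcomp_sub.
- by move=> n x; exact: gpart_in.
- by move=> n x y; exact: gpartB.
- by move=> n x; exact: gpart_id.
- by move=> n m x Mx nm; apply: (gpart_neq Mx); rewrite (inj_eq (addIr _)).
- move=> x; have [s hs] := gpart_supp x; exists [seq k - d | k <- s] => n ns.
  apply: hs; apply: contra ns => ns; apply/mapP; exists (n + d) => //.
  by rewrite addrK.
- move=> x hx; apply: gpart_inj => n; rewrite gpart0 -(hx (n - d)).
  by rewrite subrK.
Qed.

Let shift_scale m n a (x : M) : G m a -> gcomp M (n + d) x -> gcomp M (m%:Z + n + d) (a *: x).
Proof. by rewrite -addrA; exact: gcomp_scale. Qed.

Definition shiftg : gmod G := GMod shift_ds shift_scale.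
End Shift.

Lemma shiftg_hom (A B : gmod G) (f : {linear A -> B}) d :
  homogeneous0 f -> @homogeneous0 _ _ (shiftg A d) (shiftg B d) f.
Proof. by move=> hf n x; exact: hf. Qed.

Lemma shiftg_injective (E : gmod G) d : graded_injective E -> graded_injective (shiftg E d).
Proof.
move=> injE A B u f hu iu hf.
have [|||g [hg gu]] := injE (shiftg A (- d)) (shiftg B (- d)) u f.
- exact: shiftg_hom.
- exact: iu.
- by move=> n x /= /hf; rewrite /= subrK.
exists g; split=> // n x Bx; apply: (hg (n + d)) => /=.
by rewrite addrK.
Qed.

Lemma prodg_injective (A B : gmod G) :
  graded_injective A -> graded_injective B -> graded_injective (prodg A B).
Proof.
move=> iA iB M N u f hu iu hf.
have [f1 f1E] := @linear_mk R M A (fun x => (f x).1) ltac:(by move=> a x y /=; rewrite (linearP f)).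
have [f2 f2E] := @linear_mk R M B (fun x => (f x).2) ltac:(by move=> a x y /=; rewrite (linearP f)).
have [g1 [hg1 g1u]] : exists g1 : {linear N -> A}, homogeneous0 g1 /\ (forall x, g1 (u x) = f1 x).
  by apply: iA => // n x Mx; rewrite f1E; case: (hf n x Mx).
have [g2 [hg2 g2u]] : exists g2 : {linear N -> B}, homogeneous0 g2 /\ (forall x, g2 (u x) = f2 x).
  by apply: iB => // n x Mx; rewrite f2E; case: (hf n x Mx).
have [g gE] := @linear_mk R N (prodg A B) (fun x => (g1 x, g2 x))
  ltac:(by move=> a x y /=; rewrite (linearP g1) (linearP g2)).
exists g; split=> [n x Nx|x]; rewrite gE; first by split; [exact: hg1|exact: hg2].
by rewrite g1u g2u f1E f2E -surjective_pairing.
Qed.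

(** Injectivity for a map [d] that need not be injective: [g] descends to the image of [d] and
    extends from there. With [d] a differential this produces chain maps and homotopies. *)
Lemma graded_injective_factor (A B E : gmod G) (d : {linear A -> B}) (g : {linear A -> E}) :
  graded_injective E -> homogeneous0 d -> homogeneous0 g ->
  (forall x, d x = 0 -> g x = 0) ->
  exists h : {linear B -> E}, homogeneous0 h /\ forall x, h (d x) = g x.
Proof.
move=> injE hd hg dg.
pose W := [set b : B | exists a, b = d a].
have hW : submod setT W.
  split; first split; first by exists 0; rewrite linear0.
    by move=> _ _ [x ->] [y ->]; exists (x - y); rewrite linearB.
  by move=> a _ _ [x ->]; exists (a *: x); rewrite linearZ.
have homW : homogeneous_set W.
  by move=> _ n [x ->]; exists (gpart x n); rewrite homogeneous0_gpart.
pose u := subg_incl hW homW.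
(* The chosen preimages need be neither linear nor homogeneous in [w]; by [gs] the value [g (s w)]
   does not depend on the choice. *)
have /choice[s sE] : forall w : subg hW homW, exists a, u w = d a by case.
have gs w a : u w = d a -> g (s w) = g a.
  move=> ua; apply/eqP; rewrite -subr_eq0 -linearB; apply/eqP/dg.
  by rewrite linearB -sE ua subrr.
have [f fE] := @linear_mk R (subg hW homW) E (fun w => g (s w))
  ltac:(by move=> a x y /=; rewrite -linearP; apply: gs; rewrite !linearP -!sE).
have [|||h [hh hE]] := injE _ _ u f; first exact: subg_incl_hom.
- exact: subg_incl_inj.
- move=> n w Bw; rewrite fE (gs w (gpart (s w) n)); first exact/hg/gpart_in.
  by rewrite homogeneous0_gpart // -sE gpart_id.
exists h; split=> // x.
have Wx : W (d x) by exists x.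
have := hE (SubLmod hW Wx : subg hW homW); rewrite fE => -> .
exact: gs.
Qed.

End Constructions.

(** * Chain maps between injective resolutions *)

Definition linear_of (R : comNzRingType) (A B : lmodType R) (f : A -> B)
    (lf : linear f) : {linear A -> B} :=
  HB.pack f (GRing.isLinear.Build R A B *:%R f lf).

Lemma res_diffK (R : comNzRingType) (G : nat -> set R) (M : gmod G)
    (E : graded_injective_resolution M) i x :
  res_diff E i.+1 (res_diff E i x) = 0.
Proof. by apply/res_exactS; exists x. Qed.

Lemma res_diff_aug (R : comNzRingType) (G : nat -> set R) (M : gmod G)
    (E : graded_injective_resolution M) m : res_diff E 0%N (res_aug E m) = 0.
Proof. by apply/res_exact0; exists m. Qed.

Lemma torsion_linear (R : comNzRingType) (I J : set R) (A B : lmodType R)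
    (f : {linear A -> B}) x : torsion I J x -> torsion I J (f x).
Proof.
move=> [n0 h]; exists n0 => n hn a Ia; have [b Jb ab] := h n hn a Ia.
by exists b => //; rewrite -!linearZ_LR ab.
Qed.

Section ChainMaps.
Variables (R : comNzRingType) (G : nat -> set R).

Record chain_map (M N : gmod G) (E : graded_injective_resolution M)
    (E' : graded_injective_resolution N) := ChainMap {
  cmap :> forall i, {linear res_obj E i -> res_obj E' i};
  cmap_hom : forall i, homogeneous0 (cmap i);
  cmap_diff : forall i x, cmap i.+1 (res_diff E i x) = res_diff E' i (cmap i x) }.

Lemma chain_map_lift (M N : gmod G) (E : graded_injective_resolution M)
    (E' : graded_injective_resolution N) (phi : {linear M -> N}) :
  homogeneous0 phi ->
  exists f : chain_map E E', forall m, f 0%N (res_aug E m) = res_aug E' (phi m).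
Proof.
move=> hphi.
(* The recursion carries along that kernels go to kernels: this is the factorization condition for
   the next degree. *)
pose T i := {f : {linear res_obj E i -> res_obj E' i} |
  homogeneous0 f /\ forall x, res_diff E i x = 0 -> res_diff E' i (f x) = 0}.
have [f0 [hf0 f0E]] : exists h : {linear res_obj E 0 -> res_obj E' 0},
    homogeneous0 h /\ forall m, h (res_aug E m) = (res_aug E' \o phi) m.
  apply: graded_injective_factor; first exact: res_obj_injective.
  - exact: res_aug_homogeneous.
  - by move=> n x Mx; apply: res_aug_homogeneous; exact: hphi.
  - move=> x; rewrite -(linear0 (res_aug E)) => /res_aug_inj ->.
    by rewrite linear0.
have t0P : forall x, res_diff E 0 x = 0 -> res_diff E' 0 (f0 x) = 0.
  by move=> x /res_exact0[m ->]; rewrite f0E res_diff_aug.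
pose t0 : T 0%N := exist _ f0 (conj hf0 t0P).
have step i (t : T i) : {t' : T i.+1 | forall x, sval t' (res_diff E i x) = res_diff E' i (sval t x)}.
  case: t => f [hf fk] /=; apply: cid.
  have [h [hh hE]] : exists h : {linear res_obj E i.+1 -> res_obj E' i.+1},
      homogeneous0 h /\ forall x, h (res_diff E i x) = (res_diff E' i \o f) x.
    apply: graded_injective_factor; first exact: res_obj_injective.
    - exact: res_diff_homogeneous.
    - by move=> n x Mx; apply: res_diff_homogeneous; exact: hf.
    - by move=> x /fk.
  have hk : forall x, res_diff E i.+1 x = 0 -> res_diff E' i.+1 (h x) = 0.
    by move=> x /res_exactS[y ->]; rewrite hE /= res_diffK.
  by exists (exist _ h (conj hh hk)).
pose F := nat_rect T t0 (fun i t => sval (step i t)).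
have FE i x : sval (F i.+1) (res_diff E i x) = res_diff E' i (sval (F i) x).
  by rewrite /=; case: (step i (F i)).
have Fh i : homogeneous0 (sval (F i)) by case: (F i) => ? [].
by exists (ChainMap Fh FE).
Qed.

Section Homotopy.
Variables (I J : set R).
Local Notation cocycles E i := (lc_cocycles I J E i).
Local Notation coboundaries E i := (lc_coboundaries I J E i).

(* Two lifts of the same map are chain homotopic; homogeneous linear maps
   preserve torsion, so they agree on the cohomology of the torsion complex. *)
Lemma chain_map_homotopic (M N : gmod G) (E : graded_injective_resolution M)
    (E' : graded_injective_resolution N) (f g : chain_map E E') :
  (forall m, f 0%N (res_aug E m) = g 0%N (res_aug E m)) ->
  forall i z, cocycles E i z -> coboundaries E' i (f i z - g i z).
Proof.
move=> fg.
(* This is the image under the differential of the usual relation [f - g = s d + d s], so that only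
   one homotopy map occurs in each degree. It suffices because a cocycle of positive degree is a
   boundary in the full resolution. *)
have homot i : exists s : {linear res_obj E i.+1 -> res_obj E' i}, homogeneous0 s /\
    forall x, res_diff E' i (f i x) - res_diff E' i (g i x) = res_diff E' i (s (res_diff E i x)).
  elim: i => [|i [s [hs sE]]].
    have [h [hh hE]] : exists h : {linear res_obj E 1 -> res_obj E' 0}, homogeneous0 h /\
        forall x, h (res_diff E 0 x) = (f 0%N \- g 0%N) x.
      apply: graded_injective_factor; first exact: res_obj_injective.
      - exact: res_diff_homogeneous.
      - by move=> n x Mx /=; apply: gcompB; exact: cmap_hom.
      - by move=> _ /res_exact0[m ->]; rewrite /= fg subrr.
    by exists h; split=> // x; rewrite -linearB hE.
  have [h [hh hE]] : exists h : {linear res_obj E i.+2 -> res_obj E' i.+1}, homogeneous0 h /\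
      forall x, h (res_diff E i.+1 x) = (f i.+1 \- g i.+1 \- (res_diff E' i \o s)) x.
    apply: graded_injective_factor; first exact: res_obj_injective.
    - exact: res_diff_homogeneous.
    - move=> n x Mx /=; apply: gcompB; first by apply: gcompB; exact: cmap_hom.
      by apply: res_diff_homogeneous; exact: hs.
    - by move=> _ /res_exactS[x ->]; rewrite /= !cmap_diff sE subrr.
  by exists h; split=> // x; rewrite hE /= !linearB /= res_diffK subr0.
move=> [|i] z [tz dz] /=.
  by have /res_exact0[m ->] := dz; rewrite fg subrr.
(* The preimage [x] of [z] need not be torsion, but [s z] is, because [z] is. *)
have [s [hs sE]] := homot i; exists (s z); first exact: torsion_linear.
by have /res_exactS[x ->] := dz; rewrite !cmap_diff sE.
Qed.

Lemma cmap_cocycle (M N : gmod G) (E : graded_injective_resolution M)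
    (E' : graded_injective_resolution N) (f : chain_map E E') i z :
  cocycles E i z -> cocycles E' i (f i z).
Proof.
by move=> [tz dz]; split; [exact: torsion_linear|rewrite -cmap_diff dz linear0].
Qed.

Lemma cmap_coboundary (M N : gmod G) (E : graded_injective_resolution M)
    (E' : graded_injective_resolution N) (f : chain_map E E') i z :
  coboundaries E i z -> coboundaries E' i (f i z).
Proof.
case: i z => [|i] z /=; first by move->; rewrite linear0.
by move=> [y ty ->]; exists (f i y); [exact: torsion_linear|rewrite cmap_diff].
Qed.
End Homotopy.

Definition cmap_comp (M N P : gmod G) (E : graded_injective_resolution M)
    (E' : graded_injective_resolution N) (E'' : graded_injective_resolution P)
    (g : chain_map E' E'') (f : chain_map E E') : chain_map E E''.
Proof.
exists (fun i => (g i \o f i : {linear _ -> _})).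
- by move=> i n x Mx; apply: (@cmap_hom _ _ _ _ g i); exact: (@cmap_hom _ _ _ _ f i).
- by move=> i x /=; rewrite !cmap_diff.
Defined.

Definition cmap_id (M : gmod G) (E : graded_injective_resolution M) : chain_map E E.
Proof. by exists (fun i => (idfun : {linear _ -> _})) => // i n x. Defined.

Definition shift_res (M : gmod G) (E : graded_injective_resolution M) (d : int) :
  graded_injective_resolution (shiftg M d).
Proof.
apply: (@GradedInjectiveResolution R G (shiftg M d) (fun i => shiftg (res_obj E i) d)
  (@res_aug R G M E) (@res_diff R G M E)).
- by move=> i; apply: shiftg_injective; exact: res_obj_injective.
- by apply: shiftg_hom; exact: res_aug_homogeneous.
- by move=> i; apply: shiftg_hom; exact: res_diff_homogeneous.
- exact: res_aug_inj.
- exact: res_exact0.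
- exact: res_exactS.
Defined.

Section Cocone.
Variables (K M N : gmod G) (phi : {linear K -> M}) (pi : {linear M -> N}).
Hypothesis hphi : homogeneous0 phi.
Hypotheses (iphi : injective phi) (spi : forall y, exists x, y = pi x).
Hypothesis exact_phi_pi : forall x, pi x = 0 <-> exists y, x = phi y.
Variables (EM : graded_injective_resolution M) (EN : graded_injective_resolution N).
Variable P : chain_map EM EN.
Hypothesis liftP : forall m, P 0%N (res_aug EM m) = res_aug EN (pi m).

(* The mapping cocone of [P]; as [pi] is onto, it is a resolution of [K]. *)
Definition cocone_obj (i : nat) : gmod G :=
  match i with
  | 0 => res_obj EM 0
  | j.+1 => prodg (res_obj EM j.+1) (res_obj EN j)
  end.

Let diff0 (x : res_obj EM 0) : prodg (res_obj EM 1) (res_obj EN 0) :=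
  (res_diff EM 0 x, P 0%N x).
Let diff0_linear : linear diff0.
Proof. by move=> a x y; rewrite /diff0 (linearP (res_diff EM 0)) (linearP (P 0%N)). Qed.
Let diffS i (x : prodg (res_obj EM i.+1) (res_obj EN i)) :
  prodg (res_obj EM i.+2) (res_obj EN i.+1) :=
  (res_diff EM i.+1 x.1, P i.+1 x.1 - res_diff EN i x.2).
Let diffS_linear i : linear (@diffS i).
Proof.
move=> a [x x'] [y y']; rewrite /diffS /= (linearP (res_diff EM i.+1)) (linearP (P i.+1)).
by rewrite (linearP (res_diff EN i)) opprD addrACA -scalerBr.
Qed.

Definition cocone_diff (i : nat) : {linear cocone_obj i -> cocone_obj i.+1} :=
  match i with
  | 0 => linear_of diff0_linear
  | j.+1 => linear_of (@diffS_linear j)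
  end.

(** It replaces the horseshoe lemma: [EM] and [EN] may be any resolutions, and the exact sequence is
    read off from the split sequence formed by [EN] shifted by one, the cocone and [EM]. *)
Definition cocone : graded_injective_resolution K.
Proof.
exists cocone_obj (res_aug EM \o phi : {linear K -> cocone_obj 0%N}) cocone_diff.
- by case=> [|i] /=; [|apply: prodg_injective]; exact: res_obj_injective.
- by move=> n x Kx; apply: res_aug_homogeneous; exact: hphi.
- case=> [|i] n x /=.
    by move=> Mx; split; [exact: res_diff_homogeneous|exact: cmap_hom].
  move=> [Mx Nx]; split=> /=; first exact: res_diff_homogeneous.
  by apply: gcompB; [exact: cmap_hom|exact: res_diff_homogeneous].
- by apply: inj_comp iphi; exact: res_aug_inj.
- move=> x; split=> [[dx Px]|[k ->]].
    have [m xm] := (@res_exact0 _ _ _ EM x).1 dx.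
    have : res_aug EN (pi m) = res_aug EN 0 by rewrite linear0 -liftP -xm.
    by move=> /res_aug_inj/exact_phi_pi[k mk]; exists k; rewrite xm mk.
  congr pair; first exact: res_diff_aug.
  by rewrite /= liftP (exact_phi_pi _).2 ?linear0 //; exists k.
- case=> [|i] [x w] /=; split.
  + move=> [dx Pw]; have [y xy] := (@res_exactS _ _ _ EM 0 x).1 dx.
    have /res_exact0[n yn] : res_diff EN 0 (P 0%N y - w) = 0.
      by rewrite linearB -cmap_diff -xy.
    (* Surjectivity of [pi] enters here: changing [y] by an element of [M] makes [P y] equal to
       [w]. *)
    have [m nm] := spi n; exists (y - res_aug EM m).
    rewrite /= /diff0 !linearB res_diff_aug subr0 -xy liftP -nm -yn.
    by rewrite opprB addrC subrK.
  + move=> [y [-> ->]]; rewrite /diffS /= res_diffK cmap_diff subrr //.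
  + move=> [dx Pw]; have [y xy] := (@res_exactS _ _ _ EM i.+1 x).1 dx.
    have /res_exactS[v yv] : res_diff EN i.+1 (P i.+1 y - w) = 0.
      by rewrite linearB -cmap_diff -xy.
    by exists (y, v); rewrite /diffS /= -xy -yv opprB addrC subrK.
  + move=> [[y v] [-> ->]]; rewrite /diffS /= res_diffK linearB -cmap_diff res_diffK.
    by rewrite subr0 subrr.
Defined.

Definition cocone_pr : chain_map cocone EM.
Proof.
exists (fun i => match i return {linear cocone_obj i -> res_obj EM i} with
  | 0 => idfun | j.+1 => fst end).
- by case=> [|i] n x //= [].
- by case.
Defined.

(** This inclusion raises the degree by one and anticommutes with the differentials, so it is not a
    [chain_map]; followed by a comparison map to [EK] it becomes the connecting map. *)
Lemma cocone_inj_linear i : linear (fun w : res_obj EN i => (0, w) : cocone_obj i.+1).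
Proof. by move=> a x y; congr pair; rewrite /= scaler0 addr0. Qed.
Definition cocone_inj i : {linear res_obj EN i -> res_obj cocone i.+1} :=
  linear_of (@cocone_inj_linear i).

End Cocone.
End ChainMaps.

(** * The long exact sequence *)

Section LongExact.
Variables (R : comNzRingType) (G : nat -> set R) (I J : set R).
Hypothesis torsion_submod : forall A : gmod G, submod setT (@torsion R I J A).
Hypothesis torsion_gpart : forall (A : gmod G) (x : A) n,
  torsion I J x -> torsion I J (gpart x n).
Local Notation cocycles E i := (lc_cocycles I J E i).
Local Notation coboundaries E i := (lc_coboundaries I J E i).

Lemma cocycles_submod (M : gmod G) (E : graded_injective_resolution M) i :
  submod setT (cocycles E i).
Proof.
have hT := torsion_submod (res_obj E i).
split; first split.
- by split; [exact: (submod0 hT)|rewrite linear0].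
- move=> x y [tx dx] [ty dy]; split; first exact: (submodB hT).
  by rewrite linearB dx dy subrr.
- move=> a x _ [tx dx]; split; first exact: (submodZ hT).
  by rewrite linearZ_LR dx scaler0.
Qed.

Lemma coboundaries_submod (M : gmod G) (E : graded_injective_resolution M) i :
  submod setT (coboundaries E i).
Proof.
case: i => [|i] /=.
  split; first by split=> // _ _ -> ->; rewrite subrr.
  by move=> a _ _ ->; rewrite scaler0.
have hT := torsion_submod (res_obj E i).
split; first split.
- by exists 0; [exact: (submod0 hT)|rewrite linear0].
- move=> _ _ [x tx ->] [y ty ->]; exists (x - y); first exact: (submodB hT).
  by rewrite linearB.
- move=> a _ _ [x tx ->]; exists (a *: x); first exact: (submodZ hT).
  by rewrite linearZ_LR.
Qed.

(** Homogeneity of the torsion submodule enters here: the degree [n] part of a torsion preimage is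
    again a torsion preimage. *)
Lemma coboundary_gcomp (M : gmod G) (E : graded_injective_resolution M) i z n :
  coboundaries E i.+1 z -> gcomp (res_obj E i.+1) n z ->
  exists y, [/\ torsion I J y, gcomp (res_obj E i) n y & z = res_diff E i y].
Proof.
move=> [y ty zy] hz; exists (gpart y n); split; first exact: torsion_gpart.
  exact: gpart_in.
by rewrite homogeneous0_gpart ?zy ?gpart_id -?zy //; exact: res_diff_homogeneous.
Qed.

Section ShortExact.
Variables (K M N : gmod G) (phi : {linear K -> M}) (pi : {linear M -> N}).
Hypothesis hphi : homogeneous0 phi.
Hypotheses (iphi : injective phi) (spi : forall y, exists x, y = pi x).
Hypothesis exact_phi_pi : forall x, pi x = 0 <-> exists y, x = phi y.
Variables (EK : graded_injective_resolution K) (EM : graded_injective_resolution M)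
  (EN : graded_injective_resolution N).
Variables (F : chain_map EK EM) (P : chain_map EM EN).
Hypothesis liftF : forall m, F 0%N (res_aug EK m) = res_aug EM (phi m).
Hypothesis liftP : forall m, P 0%N (res_aug EM m) = res_aug EN (pi m).

Local Notation C := (cocone hphi iphi spi exact_phi_pi liftP).
Local Notation pr := (cocone_pr hphi iphi spi exact_phi_pi liftP).
Local Notation inj := (cocone_inj hphi iphi spi exact_phi_pi liftP).

(** Exactness at [H^i(M)]. If [P z] is the boundary of a torsion element [w], then [(z, w)] is a
    cocycle of the cocone, and the comparison map to [EK] carries it to the required class. *)
Lemma lc_exact_mid i n z : cocycles EM i z -> gcomp (res_obj EM i) n z ->
  coboundaries EN i (P i z) ->
  exists z', [/\ cocycles EK i z', gcomp (res_obj EK i) n z' & coboundaries EM i (z - F i z')].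
Proof.
move=> [tz dz] hz Pz.
have [c [[tc dc] hc cz]] : exists c, [/\ cocycles C i c, gcomp (res_obj C i) n c & pr i c = z].
  case: i z tz dz hz Pz => [|i] z tz dz hz Pz.
    by exists z; split=> //; split=> //=; congr pair.
  have [w [tw hw Pw]] := coboundary_gcomp Pz (cmap_hom P hz).
  exists (z, w); split=> //; split; last by congr pair; rewrite //= Pw subrr.
  (* Torsion is known only for images under linear maps, so the pair is written as a sum of two such
     images. *)
  have -> : (z, w) = (z, 0) + (0, w) :> cocone_obj EM EN i.+1.
    by congr pair; rewrite /= ?addr0 ?add0r.
  apply: (submodD (torsion_submod (cocone_obj EM EN i.+1))).
    have [l lE] := @linear_mk R (res_obj EM i.+1) (cocone_obj EM EN i.+1) (fun x => (x, 0))
      ltac:(by move=> a x y; congr pair; rewrite /= scaler0 addr0).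
    by rewrite -lE; exact: torsion_linear.
  exact: (torsion_linear (inj i)).
have [t tE] := chain_map_lift C EK (phi := idfun) (fun n x h => h).
exists (t i c); split; [exact: cmap_cocycle|exact: cmap_hom|].
rewrite -cz; have cc : cocycles C i c by [].
(* Both [pr] and [F] after [t] lift [phi], from the cocone to [EM]. *)
apply: (chain_map_homotopic (f := pr) (g := cmap_comp F t)) => // m.
by rewrite /= tE liftF.
Qed.

(** The connecting map is defined on whole resolutions, as [inj] followed by a comparison of the
    cocone with [EK]; the last clause is exactness at [H^{i+1}(K)]. *)
Lemma lc_connecting : exists delta : forall i, {linear res_obj EN i -> res_obj EK i.+1},
  [/\ forall i, homogeneous0 (delta i),
      forall i z, cocycles EN i z -> cocycles EK i.+1 (delta i z),
      forall i z, coboundaries EN i z -> coboundaries EK i.+1 (delta i z) &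
      forall i n z, cocycles EK i.+1 z -> gcomp (res_obj EK i.+1) n z ->
        coboundaries EM i.+1 (F i.+1 z) ->
        exists b, [/\ cocycles EN i b, gcomp (res_obj EN i) n b
                    & coboundaries EK i.+1 (z - delta i b)]].
Proof.
have [t tE] := chain_map_lift C EK (phi := idfun) (fun n x h => h).
have [t' t'E] := chain_map_lift EK C (phi := idfun) (fun n x h => h).
have inj_cocycle i z : cocycles EN i z -> cocycles C i.+1 (inj i z).
  move=> [tz dz]; split; first exact: torsion_linear.
  by congr pair; rewrite /= ?linear0 ?dz ?subrr.
exists (fun i => t i.+1 \o inj i : {linear _ -> _}); split.
- move=> i n x hx; apply: (cmap_hom t); split=> //=.
  exact: gcomp0.
- by move=> i z hz; apply: cmap_cocycle; exact: inj_cocycle.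
- move=> i z hz; apply: cmap_coboundary.
  case: i z hz => [|i] z /= hz.
    by exists 0; [exact: (submod0 (torsion_submod _))|rewrite hz !linear0].
  (* The sign compensates for [inj] anticommuting with the differentials. *)
  have [y ty ->] := hz; exists (inj i (- y)).
    by apply: torsion_linear; exact: (submodN (torsion_submod _)).
  by congr pair; rewrite /= ?linear0 // sub0r linearN opprK.
- move=> i n z cz hz [w tw Fz].
  (* [pr] after [t'] and [F] both lift [phi], so they differ on [z] by a coboundary, and [F z] is
     one by assumption. *)
  have [u tu zu] : coboundaries EM i.+1 (pr i.+1 (t' i.+1 z)).
    have := chain_map_homotopic (f := cmap_comp pr t') (g := F) _ cz.
    move=> /(_ _)[|v tv /= e]; first by move=> m; rewrite /= t'E liftF.
    exists (v + w); first exact: (submodD (torsion_submod _)).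
    by rewrite linearD -e -Fz subrK.
  have hprz : gcomp (res_obj EM i.+1) n (pr i.+1 (t' i.+1 z)) by do 2! apply: cmap_hom.
  have [v [tv hv zv]] : exists y, [/\ torsion I J y, gcomp (res_obj EM i) n y
      & pr i.+1 (t' i.+1 z) = res_diff EM i y].
    by apply: coboundary_gcomp hprz; exists u.
  have [tc dc] := cmap_cocycle t' cz.
  (* The first component of [t' z] is the boundary of [v]; subtracting the cocone boundary of [v]
     clears it and leaves [b] in the second. *)
  pose b := (t' i.+1 z).2 - P i v.
  have [sn snE] := @linear_mk R (cocone_obj EM EN i.+1) (res_obj EN i) (fun x => x.2)
    ltac:(by []).
  have tb : torsion I J b.
    apply: (submodB (torsion_submod _)); last exact: torsion_linear.
    by rewrite -snE; exact: torsion_linear.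
  have c1 : (t' i.+1 z).1 = res_diff EM i v by exact: zv.
  exists b; split.
  + split=> //; have /(congr1 snd)/= := dc.
    rewrite c1 cmap_diff => e.
    by rewrite /b linearB -opprB e oppr0.
  + apply: gcompB; last exact: cmap_hom.
    by have [] : gcomp (res_obj C i.+1) n (t' i.+1 z) by exact: cmap_hom.
  + (* the cocycle [t' z] of the cocone differs from [(0, b)] by a coboundary *)
    have cb : coboundaries C i.+1 (t' i.+1 z - inj i b).
      (* The cases differ because the cocone has only the summand from [EM] in degree 0: there the
         preimage is [v], and [(v, 0)] in higher degrees. *)
      case: i z cz hz w tw Fz u tu zu hprz v tv hv zv tc dc @b sn snE tb c1 =>
        [|i] z cz hz w tw Fz u tu zu hprz v tv hv zv tc dc b sn snE tb c1.
        exists v => //; rewrite [LHS]surjective_pairing; congr pair.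
          by rewrite /= subr0.
        by rewrite /= /b opprB addrC subrK.
      exists (v, 0).
        have [l lE] := @linear_mk R (res_obj EM i.+1) (cocone_obj EM EN i.+1)
          (fun x => (x, 0)) ltac:(by move=> a x y; congr pair; rewrite /= scaler0 addr0).
        by rewrite -lE; exact: torsion_linear.
      rewrite [LHS]surjective_pairing; congr pair; first by rewrite /= subr0.
      by rewrite /= /b linear0 subr0 opprB addrC subrK.
    have h1 := cmap_coboundary t cb.
    have h2 := chain_map_homotopic (f := cmap_comp t t') (g := cmap_id EK) _ cz.
    have {}h2 : coboundaries EK i.+1 (t i.+1 (t' i.+1 z) - z).
      by apply: h2 => m; rewrite /= t'E tE.
    have := submodB (coboundaries_submod EK i.+1) h1 h2.
    by rewrite linearB opprB addrC addrA subrK.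
Qed.

(** Cocycles of degree 0 are elements of [K], on which [F] acts as the injective [phi]. *)
Lemma lc_mono0 z : cocycles EK 0 z -> F 0%N z = 0 -> z = 0.
Proof.
move=> [_ /res_exact0[k ->]]; rewrite liftF -(linear0 (res_aug EM)).
by move=> /res_aug_inj; rewrite -(linear0 phi) => /iphi ->; rewrite linear0.
Qed.
End ShortExact.
End LongExact.

(** * Finitely generated subquotients *)

Lemma subrACA (V : zmodType) (a b c d : V) : (a - b) - (c - d) = (a - c) - (b - d).
Proof. by rewrite opprD addrACA -opprD. Qed.

Lemma Zorn_above (T : Type) (P : set (set T)) (A0 : set T) :
  P A0 -> A0 !=set0 ->
  (forall F : set (set T), F !=set0 -> F `<=` P -> total_on F subset ->
     P (\bigcup_(X in F) X)) ->
  exists A, [/\ P A, A0 `<=` A & forall B, P B -> A `<=` B -> B `<=` A].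
Proof.
move=> PA0 [x0 A0x0] chainP.
pose Q : set (set T) := fun X => X = set0 \/ (P X /\ A0 `<=` X).
have [F FQ totF|A [QA maxA]] := @Zorn_bigcup T Q.
  have [[X FX X0]|noF] := pselect (exists2 X, F X & X <> set0); last first.
    left; apply/seteqP; split=> // x [X FX Xx]; exfalso; apply: noF.
    by exists X => // X0; rewrite X0 in Xx.
  pose F' : set (set T) := fun Y => F Y /\ Y <> set0.
  have -> : \bigcup_(Y in F) Y = \bigcup_(Y in F') Y.
    apply/seteqP; split=> x [Y FY Yx]; exists Y => //; last by case: FY.
    by split=> // Y0; rewrite Y0 in Yx.
  have F'P Y : F' Y -> P Y /\ A0 `<=` Y by move=> [/FQ[]].
  right; split.
    apply: chainP => [|Y /F'P[]//|Y Z [FY _] [FZ _]]; last exact: totF.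
    by exists X.
  by move=> x A0x; exists X => //; apply: (F'P X _).2.
case: QA => [A_0|[PA A0A]].
  exfalso; apply: (maxA A0); last by right; split=> // x.
  rewrite A_0; split=> // /(_ x0 A0x0) //.
exists A; split=> // B PB AB; apply: contrapT => BA.
apply: (maxA B); first by split.
by right; split=> // x /A0A/AB.
Qed.

(** * Noetherian arguments for modules over a subring *)

Section Span.
Variables (R : comNzRingType) (S : set R).

Definition lspan (V : lmodType R) (A : set V) : set V :=
  [set x | forall W, submod S W -> A `<=` W -> W x].

Lemma lspan_submod (V : lmodType R) (A : set V) : submod S (lspan A).
Proof.
split; first split=> [W hW _|x y hx hy W hW AW]; first exact: (submod0 hW).
  by apply: (submodB hW); [exact: hx|exact: hy].
by move=> a x Sa hx W hW AW; apply: (submodZ hW) => //; exact: hx.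
Qed.

Lemma sub_lspan (V : lmodType R) (A : set V) : A `<=` lspan A.
Proof. by move=> x Ax W _; apply. Qed.

Lemma lspan_le (V : lmodType R) (A W : set V) :
  submod S W -> A `<=` W -> lspan A `<=` W.
Proof. by move=> hW AW x; apply. Qed.

Lemma lspan_mono (V : lmodType R) (A B : set V) : A `<=` B -> lspan A `<=` lspan B.
Proof. by move=> AB x hx W hW BW; apply: hx => // y /AB/BW. Qed.

(** The list [s] need not lie in [Z], so the property passes to subsets of [Z]; the induction in
    [fg_sub] relies on this. *)
Definition fg_by (V : lmodType R) (s : seq V) (Z B : set V) :=
  forall z, Z z -> exists2 w, lspan [set` s] w & B (z - w).

Definition fg_mod (V : lmodType R) (Z B : set V) :=
  exists s : seq V, (forall g, g \in s -> Z g) /\ fg_by s Z B.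

(** A relative form of [noetherian] that also applies to the base ring [G 0]. *)
Definition noeth := forall I : set R, ideal_in S I ->
  exists s : seq R^o, (forall c, c \in s -> I c) /\ I `<=` lspan [set` s].

Hypothesis hS : subring S.

Lemma lspan_nil (V : lmodType R) (x : V) : lspan [set` [::]] x -> x = 0.
Proof.
apply: (@lspan_le _ _ [set 0]); last by move=> y; rewrite /= in_nil.
split; first by split=> // _ _ -> ->; rewrite subrr.
by move=> a _ _ ->; rewrite scaler0.
Qed.

Lemma lspan_cons (V : lmodType R) (g : V) s x : lspan [set` g :: s] x ->
  exists c w, [/\ S c, lspan [set` s] w & x = c *: g + w].
Proof.
have [[S0 SB] S1 SM] := hS; have hs := lspan_submod [set` s].
apply: (@lspan_le _ _ [set x | exists c w, [/\ S c, lspan [set` s] w & x = c *: g + w]]).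
  split; first split.
  - by exists 0, 0; split=> //; [exact: (submod0 hs)|rewrite scale0r addr0].
  - move=> _ _ [c [w [Sc hw ->]]] [d [v [Sd hv ->]]]; exists (c - d), (w - v); split.
    + exact: SB.
    + exact: (submodB hs).
    + by rewrite scalerBl opprD addrACA.
  - move=> a _ Sa [c [w [Sc hw ->]]]; exists (a * c), (a *: w); split.
    + exact: SM.
    + exact: (submodZ hs).
    + by rewrite scalerDr scalerA.
move=> y /=; rewrite inE => /predU1P[->|ys].
  by exists 1, 0; split=> //; [exact: (submod0 hs)|rewrite scale1r addr0].
by exists 0, y; split=> //; [exact: sub_lspan|rewrite scale0r add0r].
Qed.

Lemma lspan_coef (V : lmodType R) (s : seq V) x : lspan [set` s] x ->
  exists c : 'I_(size s) -> R, (forall j, S (c j)) /\ x = \sum_j c j *: s`_j.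
Proof.
have [[S0 SB] S1 SM] := hS.
elim: s x => [|g s IH] x.
  by move/lspan_nil ->; exists (fun=> 0); split=> //; rewrite big_ord0.
move=> /lspan_cons[c [w [Sc /IH[d [Sd ->]] ->]]].
exists (fun j => if unlift ord0 j is Some i then d i else c); split.
  by move=> j; case: unliftP.
rewrite big_ord_recl unlift_none; congr +%R.
by apply: eq_bigr => j _; rewrite liftK.
Qed.

Lemma subquot_fgP (V : lmodType R) (Z B : set V) : subquot_fg S Z B <-> fg_mod Z B.
Proof.
split=> [[k [g [Zg hg]]]|[s [Zs hs]]].
  exists (codom g); split=> [_ /codomP[j ->] //|z /hg[c [Sc Bc]]].
  exists (\sum_(j < k) c j *: g j) => //.
  have hsp := lspan_submod [set` codom g].
  apply: asub_sum; first by case: hsp.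
  by move=> j _; apply: (submodZ hsp) => //; apply: sub_lspan; exact: codom_f.
exists (size s), (fun j => s`_j); split=> [j|z /hs[w /lspan_coef[c [Sc ->]] Bw]].
  by apply: Zs; exact: mem_nth.
by exists c.
Qed.

Hypothesis nS : noeth.

(** Induction on [s]. The possible coefficients of the first generator [g] form an ideal of [S];
    lifts of finitely many generators of that ideal, together with generators of the elements that
    have coefficient 0, generate [Z]. *)
Lemma fg_sub (V : lmodType R) (Z B : set V) (s : seq V) :
  submod S Z -> submod S B -> fg_by s Z B -> fg_mod Z B.
Proof.
have [[S0 SB] S1 SM] := hS.
move=> + hB; elim: s Z => [|g s IH] Z hZ sZ; first by exists [::].
have hs := lspan_submod [set` s].
(* A relation and not a function: [g] may be dependent on [s] modulo [B]. *)
pose Lead (c : R) z := exists2 w, lspan [set` s] w & B (z - c *: g - w).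
have LeadB c d z y : Lead c z -> Lead d y -> Lead (c - d) (z - y).
  move=> [w hw Bw] [v hv Bv]; exists (w - v); first exact: (submodB hs).
  by have := submodB hB Bw Bv; rewrite subrACA (subrACA z) -scalerBl.
have LeadZ a c z : S a -> Lead c z -> Lead (a * c) (a *: z).
  move=> Sa [w hw Bw]; exists (a *: w); first exact: (submodZ hs).
  by have := submodZ hB Sa Bw; rewrite !scalerBr scalerA.
have Lead0 : Lead 0 0.
  by exists 0; [exact: (submod0 hs)|rewrite scale0r !subr0; exact: (submod0 hB)].
pose I c := S c /\ exists2 z, Z z & Lead c z.
have idI : ideal_in S I.
  split=> [c []//||a c Sa [Sc [z Zz cz]]]; last first.
    by split; [exact: SM|exists (a *: z); [exact: (submodZ hZ)|exact: LeadZ]].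
  split; first by split=> //; exists 0 => //; exact: (submod0 hZ).
  move=> c d [Sc [z Zz cz]] [Sd [y Zy dy]]; split; first exact: SB.
  by exists (z - y); [exact: (submodB hZ)|exact: LeadB].
have [cs [csI Ics]] := nS idI.
have /choice[f fP] : forall c : R^o, exists z, c \in cs -> Z z /\ Lead c z.
  move=> c; have [cc|_] := boolP (c \in cs); last by exists 0.
  by have [_ [z Zz cz]] := csI c cc; exists z.
pose Z' z := Z z /\ exists2 w, lspan [set` s] w & B (z - w).
have hZ' : submod S Z'.
  split; first split.
  - split; first exact: (submod0 hZ).
    by exists 0; [exact: (submod0 hs)|rewrite subr0; exact: (submod0 hB)].
  - move=> z y [Zz [w hw Bw]] [Zy [v hv Bv]]; split; first exact: (submodB hZ).
    exists (w - v); first exact: (submodB hs).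
    by have := submodB hB Bw Bv; rewrite subrACA.
  - move=> a z Sa [Zz [w hw Bw]]; split; first exact: (submodZ hZ).
    exists (a *: w); first exact: (submodZ hs).
    by have := submodZ hB Sa Bw; rewrite scalerBr.
have [s' [s'Z' s'P]] := IH Z' hZ' (fun z hz => hz.2).
exists (s' ++ map f cs); split.
  move=> y; rewrite mem_cat => /orP[/s'Z'[]//|/mapP[c cc ->]].
  by case: (fP c cc).
pose A := [set` s' ++ map f cs].
have hA := lspan_submod A.
have lift c : lspan [set` cs] c -> exists2 z, Z z /\ lspan [set` map f cs] z & Lead c z.
  have hf := lspan_submod [set` map f cs].
  apply: (@lspan_le _ _ [set c : R^o |
    exists2 z, Z z /\ lspan [set` map f cs] z & Lead c z]).
    split; first split.
    - by exists 0 => //; split; [exact: (submod0 hZ)|exact: (submod0 hf)].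
    - move=> c' d [z [Zz fz] cz] [y [Zy fy] dy]; exists (z - y); last exact: LeadB.
      by split; [exact: (submodB hZ)|exact: (submodB hf)].
    - move=> a c' Sa [z [Zz fz] cz]; exists (a *: z); last exact: LeadZ.
      by split; [exact: (submodZ hZ)|exact: (submodZ hf)].
  move=> c' cc; have [Zf Lf] := fP c' cc; exists (f c') => //; split=> //.
  by apply: sub_lspan; exact: map_f.
move=> z Zz; have [v /lspan_cons[c [w [Sc hw ->]]] Bz] := sZ z Zz.
have Ic : I c by split=> //; exists z => //; exists w => //; rewrite -addrA -opprD.
have [y [Zy fy] cy] := lift c (Ics c Ic).
have cz : Lead c z by exists w => //; rewrite -addrA -opprD.
have [u hu Bu] : exists2 u, lspan [set` s'] u & B (z - y - u).
  apply: s'P; split; first exact: (submodB hZ).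
  by have := LeadB _ _ _ _ cz cy; rewrite subrr => -[w' hw' Bw']; exists w' => //; rewrite scale0r subr0 in Bw'.
exists (y + u); last by rewrite opprD addrA.
apply: (submodD hA).
  by apply: lspan_mono fy => x /= xf; rewrite /A /= mem_cat xf orbT.
by apply: lspan_mono hu => x /= xs; rewrite /A /= mem_cat xs.
Qed.

(* Middle term of an exact sequence [Z1/B1 -> Z2/B2 -> Z3/B3]. *)
Lemma fg_exact (V1 V2 V3 : lmodType R) (Z1 B1 : set V1) (Z2 B2 : set V2) (Z3 B3 : set V3)
    (al : {linear V1 -> V2}) (be : {linear V2 -> V3}) :
  submod S Z2 -> submod S B2 -> submod S B3 ->
  (forall z, Z1 z -> Z2 (al z)) -> (forall z, B1 z -> B2 (al z)) ->
  (forall z, Z2 z -> Z3 (be z)) ->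
  (forall z, Z2 z -> B3 (be z) -> exists2 z1, Z1 z1 & B2 (z - al z1)) ->
  fg_mod Z1 B1 -> fg_mod Z3 B3 -> fg_mod Z2 B2.
Proof.
move=> hZ2 hB2 hB3 alZ alB beZ ex [s1 [s1Z s1P]] [s3 [_ s3P]].
(* The image of [Z2] is finitely generated modulo [B3] by [fg_sub]; its generators lift to [Z2] and
   join those coming from [Z1]. *)
pose Z3' y := exists2 z, Z2 z & y = be z.
have hZ3' : submod S Z3'.
  split; first split.
  - by exists 0; [exact: (submod0 hZ2)|rewrite linear0].
  - by move=> _ _ [x hx ->] [y hy ->]; exists (x - y); [exact: (submodB hZ2)|rewrite linearB].
  - by move=> a _ Sa [x hx ->]; exists (a *: x); [exact: (submodZ hZ2)|rewrite linearZ_LR].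
have [t [tZ tP]] : fg_mod Z3' B3.
  by apply: (fg_sub (s := s3)) => // _ [z hz ->]; apply: s3P; exact: beZ.
have /choice[f fP] : forall y, exists z, y \in t -> Z2 z /\ y = be z.
  move=> y; have [yt|_] := boolP (y \in t); last by exists 0.
  by have [z hz ->] := tZ y yt; exists z.
exists (map f t ++ map al s1); split.
  move=> y; rewrite mem_cat => /orP[/mapP[x xt ->]|/mapP[x xs ->]].
    by have [] := fP x xt.
  exact/alZ/s1Z.
have hA := lspan_submod [set` map f t ++ map al s1].
move=> z hz; have [w hw Bw] : exists2 w, lspan [set` t] w & B3 (be z - w).
  by apply: tP; exists z.
have [v [Zv fv] wv] : exists2 v, Z2 v /\ lspan [set` map f t] v & w = be v.
  have hf := lspan_submod [set` map f t].
  apply: (@lspan_le _ _ [set w | exists2 v, Z2 v /\ lspan [set` map f t] v & w = be v] _ _ _ hw).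
    split; first split.
    - by exists 0; rewrite ?linear0 //; split; [exact: (submod0 hZ2)|exact: (submod0 hf)].
    - move=> _ _ [x [Zx fx] ->] [y [Zy fy] ->]; exists (x - y); rewrite ?linearB //.
      by split; [exact: (submodB hZ2)|exact: (submodB hf)].
    - move=> a _ Sa [x [Zx fx] ->]; exists (a *: x); rewrite ?linearZ_LR //.
      by split; [exact: (submodZ hZ2)|exact: (submodZ hf)].
  move=> y yt; have [Zf yf] := fP y yt; exists (f y) => //; split=> //.
  by apply: sub_lspan; exact: map_f.
have [|z1 Zz1 Bz1] := ex (z - v) (submodB hZ2 hz Zv); first by rewrite linearB -wv.
have [u hu Bu] := s1P z1 Zz1.
have alu : lspan [set` map al s1] (al u).
  have hf := lspan_submod [set` map al s1].
  apply: (hu [set u | lspan [set` map al s1] (al u)]).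
    split; first split=> /=.
    - by rewrite linear0; exact: (submod0 hf).
    - by move=> x y; rewrite linearB; exact: (submodB hf).
    - by move=> a x Sa; rewrite /= linearZ_LR; exact: (submodZ hf).
  by move=> x xs /=; apply: sub_lspan; exact: map_f.
exists (v + al u).
  apply: (submodD hA).
    by apply: lspan_mono fv => x /= xf; rewrite mem_cat xf.
  by apply: lspan_mono alu => x /= xs; rewrite mem_cat xs orbT.
have := submodD hB2 Bz1 (alB _ Bu).
by rewrite linearB addrA subrK opprD addrA.
Qed.

(** The first hypothesis says that [x] lies in the Jacobson radical of [S]. Generators are removed
    one at a time: [g] is congruent to [x (c g + w0)], and the unit [1 - x c] solves this for [g] in
    terms of the others. *)
Lemma nakayama (V : lmodType R) (Z B : set V) (x : R) :
  (forall c, S c -> S (x * c) /\ exists2 u, S u & u * (1 - x * c) = 1) ->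
  submod S Z -> submod S B -> fg_mod Z B ->
  (forall z, Z z -> exists2 z', Z z' & B (z - x *: z')) -> Z `<=` B.
Proof.
have [[S0 SB] S1 SM] := hS.
move=> hx hZ hB [s [sZ sP]] ZxZ; elim: s sZ sP => [|g s IH] sZ sP.
  by move=> z /sP[w /lspan_nil ->]; rewrite subr0.
have hs := lspan_submod [set` s].
apply: IH => [y ys|z Zz]; first by apply: sZ; rewrite inE ys orbT.
have Zg : Z g by apply: sZ; rewrite inE eqxx.
have [z' Zz' Bg] := ZxZ g Zg.
have [_ /lspan_cons[c [w0 [Sc hw0 ->]]] Bz'] := sP z' Zz'.
have [Sxc [u Su uE]] := hx c Sc.
have Sx : S x by have [] := hx 1 S1; rewrite mulr1.
have Bg2 : B (g - (u * x) *: w0).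
  have := submodZ hB Su (submodD hB Bg (submodZ hB Sx Bz')).
  congr (B _).
  rewrite scalerBr addrA subrK [x *: (_ + _)]scalerDr scalerA opprD addrA.
  by rewrite -{1}(scale1r g) -scalerBl scalerBr !scalerA uE scale1r.
have [_ /lspan_cons[d [w [Sd hw ->]]] Bz] := sP z Zz.
exists ((d * (u * x)) *: w0 + w).
  by apply: (submodD hs) => //; apply: (submodZ hs) => //; apply: (SM) => //; exact: SM.
have := submodD hB Bz (submodZ hB Sd Bg2); congr (B _).
by rewrite scalerBr scalerA opprD !addrA [z - _ - _]addrAC subrK opprD addrA addrAC.
Qed.

End Span.

(** Otherwise Zorn puts the proper ideal generated by [1 - a] into a maximal ideal; this is [m],
    which then contains both [a] and [1 - a]. *)
Lemma local_in_unit (R : comNzRingType) (S m : set R) a :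
  subring S -> local_in S m -> m a -> exists2 u, S u & u * (1 - a) = 1.
Proof.
move=> [[S0 SB] S1 SM] [[[mS [m0 mB] mM] mneS maxm] uniqm] ma.
have SN b : S b -> S (- b) by move=> Sb; rewrite -sub0r; exact: SB.
pose P := [set x | exists2 r, S r & x = r * (1 - a)].
have [|nP1] := pselect (P 1); first by move=> [r Sr e]; exists r.
exfalso.
have idP : ideal_in S P.
  split=> [_ [r Sr ->]||b _ Sb [r Sr ->]]; first by apply: SM => //; apply: SB => //; exact: mS.
    split; first by exists 0; rewrite ?mul0r.
    by move=> _ _ [r Sr ->] [r' Sr' ->]; exists (r - r'); [exact: SB|rewrite mulrBl].
  by exists (b * r); [exact: SM|rewrite mulrA].
have [|||M1 [[idM nM1] PM maxM]] := @Zorn_above R (fun X => ideal_in S X /\ ~ X 1) P.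
- by [].
- by exists 0; case: idP => _ [].
- move=> F [X FX] FP totF; split; last by move=> [Y /FP[_ nY] /nY].
  have Fid Y : F Y -> ideal_in S Y by move=> /FP[].
  split.
  + by move=> x [Y /Fid[YS _ _] /YS].
  + split; first by exists X => //; case: (Fid X FX) => _ [].
    move=> x y [Y FY Yx] [Z FZ Zy].
    have [YZ|ZY] := totF Y Z FY FZ.
      by exists Z => //; case: (Fid Z FZ) => _ [_ ZB] _; apply: ZB => //; exact: YZ.
    by exists Y => //; case: (Fid Y FY) => _ [_ YB] _; apply: YB => //; exact: ZY.
  + by move=> b x Sb [Y FY Yx]; exists Y => //; case: (Fid Y FY) => _ _; apply.
have maxM1 : maximal_ideal_in S M1.
  split=> // [MS|I idI MI]; first by apply: nM1; rewrite MS.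
  have [I1|nI1] := pselect (I 1).
    right; apply/seteqP; split; first by case: idI.
    by move=> x Sx; rewrite -(mulr1 x); case: idI => _ _; apply.
  by left; apply/seteqP; split=> //; exact: maxM.
have M1m := uniqm _ maxM1; apply: nM1; rewrite M1m.
have m1a : m (1 - a) by rewrite -M1m; apply: PM; exists 1; rewrite ?mul1r.
by have := mB _ _ m1a (mB _ _ m0 ma); rewrite sub0r opprK subrK.
Qed.

(** * Ideals *)

Section Ideals.
Variable R : comNzRingType.
Implicit Types (I J Q : set R) (a b : R).
Local Notation ideal := (ideal_in (setT : set R)).

Lemma ideal_add Q a b : ideal Q -> Q a -> Q b -> Q (a + b).
Proof. by move=> [_ hQ _]; exact: asubD. Qed.
Lemma ideal_sub Q a b : ideal Q -> Q a -> Q b -> Q (a - b).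
Proof. by move=> [_ hQ _]; exact: asubB. Qed.
Lemma ideal_zero Q : ideal Q -> Q 0.
Proof. by move=> [_ hQ _]; exact: asub0. Qed.
Lemma ideal_mull Q a b : ideal Q -> Q b -> Q (a * b).
Proof. by move=> [_ _ hQ]; exact: hQ. Qed.
Lemma ideal_mulr Q a b : ideal Q -> Q a -> Q (a * b).
Proof. by rewrite mulrC; exact: ideal_mull. Qed.

Lemma ideal_mk Q : Q 0 -> (forall a b, Q a -> Q b -> Q (a - b)) ->
  (forall a b, Q b -> Q (a * b)) -> ideal Q.
Proof. by move=> Q0 QB QM; split=> // a b _; exact: QM. Qed.

Lemma ideal_setT : ideal setT. Proof. exact: ideal_mk. Qed.

Lemma ideal_gen_ideal (A : set R) : ideal (ideal_gen A).
Proof.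
apply: ideal_mk => [X [hX _]|a b ha hb X hX|a b hb X hX]; first exact: ideal_zero.
  by apply: (ideal_sub hX.1); [exact: ha|exact: hb].
by apply: (ideal_mull _ hX.1); exact: hb.
Qed.

Lemma sub_ideal_gen (A : set R) : A `<=` ideal_gen A.
Proof. by move=> x Ax X [_]; apply. Qed.

Lemma ideal_gen_le (A Q : set R) : ideal Q -> A `<=` Q -> ideal_gen A `<=` Q.
Proof. by move=> hQ AQ x hx; apply: hx. Qed.

Lemma ideal_pow_ideal I n : ideal (ideal_pow I n).
Proof. by case: n => [|n]; [exact: ideal_setT|exact: ideal_gen_ideal]. Qed.

Lemma ideal_powS I n a b : I a -> ideal_pow I n b -> ideal_pow I n.+1 (a * b).
Proof. by move=> Ia Ib; apply: sub_ideal_gen; exists a, b. Qed.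

Lemma ideal_powS_le I n Q : ideal Q ->
  (forall a b, I a -> ideal_pow I n b -> Q (a * b)) -> ideal_pow I n.+1 `<=` Q.
Proof. by move=> hQ h; apply: ideal_gen_le => // _ [a [b [Ia Ib ->]]]; exact: h. Qed.

Lemma ideal_pow_exp I n a : I a -> ideal_pow I n (a ^+ n).
Proof. by move=> Ia; elim: n => // n IH; rewrite exprS; exact: ideal_powS. Qed.

Lemma ideal_powM I m n a b :
  ideal_pow I m a -> ideal_pow I n b -> ideal_pow I (m + n)%N (a * b).
Proof.
move=> + Ib; elim: m a => [|m IH] a; first by move=> _; exact: ideal_mull (ideal_pow_ideal I n) Ib.
have hI := ideal_pow_ideal I (m + n).+1.
apply: (ideal_powS_le (Q := [set a | ideal_pow I (m + n).+1 (a * b)])) => [|x y Ix Iy].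
  apply: ideal_mk => /= [|x y hx hy|x y hy]; first by rewrite mul0r; exact: (ideal_zero hI).
    by rewrite mulrBl; exact: (ideal_sub hI).
  by rewrite -mulrA; exact: (ideal_mull _ hI).
by rewrite /= -mulrA; apply: ideal_powS => //; exact: IH.
Qed.

Lemma ideal_pow_anti I m n : (m <= n)%N -> ideal_pow I n `<=` ideal_pow I m.
Proof.
move=> /subnKC <-; elim: (n - m)%N => [|k IH]; first by rewrite addn0.
rewrite addnS; apply: ideal_powS_le => [|a b _ /IH]; first exact: ideal_pow_ideal.
exact: ideal_mull (ideal_pow_ideal I m).
Qed.

Lemma ideal_pow_mono I J n : I `<=` J -> ideal_pow I n `<=` ideal_pow J n.
Proof.
move=> IJ; elim: n => // n IH; apply: ideal_powS_le => [|a b /IJ Ja /IH Jb].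
  exact: ideal_pow_ideal.
exact: ideal_powS.
Qed.

Lemma ideal_powD_le I m n Q : ideal Q ->
  (forall a b, ideal_pow I m a -> ideal_pow I n b -> Q (a * b)) ->
  ideal_pow I (m + n)%N `<=` Q.
Proof.
elim: m Q => [|m IH] Q hQ h.
  by move=> b Ib; rewrite -(mul1r b); exact: h.
apply: ideal_powS_le => // x c Ix.
apply: (IH [set c | Q (x * c)]) => [|a b Ia Ib /=].
  apply: ideal_mk => /= [|a b ha hb|a b hb]; first by rewrite mulr0; exact: ideal_zero.
    by rewrite mulrBr; exact: ideal_sub.
  by rewrite mulrCA; exact: ideal_mull.
by rewrite mulrA; apply: h => //; exact: ideal_powS.
Qed.

Lemma ideal_add_principal Q y : ideal Q -> ideal [set a | exists q r, Q q /\ a = q + r * y].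
Proof.
move=> hQ; apply: ideal_mk => [|_ _ [q [r [Qq ->]]] [q' [r' [Qq' ->]]]|a _ [q [r [Qq ->]]]].
- by exists 0, 0; rewrite mul0r addr0; split=> //; exact: ideal_zero.
- by exists (q - q'), (r - r'); rewrite mulrBl opprD addrACA; split=> //; exact: ideal_sub.
- by exists (a * q), (a * r); rewrite mulrDr mulrA; split=> //; exact: ideal_mull.
Qed.

(** Induction on the list and on the exponent of its head [y]. If [y^(e+1)] is in [Q], the colon
    ideal [Q : y] contains [y^e], and modulo [Q + yR] only the tail matters; an element of [Q + yR]
    times one of [Q : y] lies in [Q]. *)
Lemma ideal_pow_sub_of_gens (s : seq R) Q : ideal Q ->
  (forall y, y \in s -> exists e, Q (y ^+ e)) ->
  exists m, ideal_pow (ideal_gen [set` s]) m `<=` Q.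
Proof.
elim: s Q => [|y s IH] Q hQ sQ.
  exists 1%N; apply: ideal_powS_le => // a b Ia _; apply: (ideal_mulr _ hQ).
  suff -> : a = 0 by exact: ideal_zero.
  apply: (Ia [set 0]); split=> //; apply: ideal_mk => // [? ? -> ->|? ? ->].
    by rewrite subrr.
  by rewrite mulr0.
set I := ideal_gen _.
have [e] : exists e, Q (y ^+ e) by apply: sQ; rewrite inE eqxx.
elim: e Q hQ sQ => [|e IHe] Q hQ sQ.
  by rewrite expr0 => Q1; exists 0%N => a _; rewrite -(mulr1 a); exact: ideal_mull.
move=> Qye.
have [m1 hm1] : exists m, ideal_pow I m `<=` [set a | Q (a * y)].
  apply: IHe => /= [|z zs|]; last by rewrite -exprSr.
    apply: ideal_mk => /= [|a b ha hb|a b hb]; first by rewrite mul0r; exact: ideal_zero.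
      by rewrite mulrBl; exact: ideal_sub.
    by rewrite -mulrA; exact: ideal_mull.
  by have [f Qf] := sQ z zs; exists f; exact: ideal_mulr.
pose L I' := [set a | exists q r, I' q /\ a = q + r * y].
have hL I' : ideal I' -> ideal (L I') by exact: ideal_add_principal.
have [m2 hm2] : exists m, ideal_pow (ideal_gen [set` s]) m `<=` L Q.
  apply: IH => [|z]; first exact: hL.
  move=> zs; have [|f Qf] := sQ z; first by rewrite inE zs orbT.
  by exists f, (z ^+ f), 0; rewrite mul0r addr0.
have {hm2}hm2 : ideal_pow I m2 `<=` L Q.
  pose I' := ideal_gen [set` s].
  have IL1 : I `<=` L I'.
    have hI := ideal_gen_ideal [set` s].
    apply: ideal_gen_le => [|z /=]; first exact: hL.
    rewrite inE => /predU1P[->|zs].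
      by exists 0, 1; rewrite add0r mul1r; split=> //; exact: (ideal_zero hI).
    by exists z, 0; rewrite mul0r addr0; split=> //; exact: sub_ideal_gen.
  have IL m : ideal_pow I m `<=` L (ideal_pow I' m).
    elim: m => [|m IHm]; first by move=> a _; exists a, 0; rewrite mul0r addr0.
    apply: ideal_powS_le => [|a b /IL1[q [r [Iq ->]]] /IHm[q' [r' [Iq' ->]]]].
      exact/hL/ideal_pow_ideal.
    exists (q * q'), (q * r' + r * (q' + r' * y)); split; first exact: ideal_powS.
    by ring.
  move=> a /IL[q [r [/hm2[q' [r' [Qq' ->]]] ->]]]; exists q', (r' + r).
  by rewrite mulrDl addrA.
exists (m2 + m1)%N; apply: ideal_powD_le => // a b /hm2[q [r [Qq ->]]] /hm1/= Qb.
rewrite mulrDl -mulrA [y * b]mulrC; apply: ideal_add => //; first exact: ideal_mulr.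
exact: ideal_mull.
Qed.

Lemma radical_ideal Q : ideal Q -> ideal [set a | exists m, Q (a ^+ m)].
Proof.
move=> hQ; have QX a m n : (m <= n)%N -> Q (a ^+ m) -> Q (a ^+ n).
  by move=> /subnK <- Qa; rewrite exprD; exact: ideal_mull.
apply: ideal_mk => /= [|a b [m Qa] [n Qb]|a b [m Qb]].
- by exists 1%N; rewrite expr1; exact: ideal_zero.
- exists (m + n)%N; rewrite exprDn.
  case: (hQ) => _ hA _; apply: asub_sum => // i _; rewrite -mulr_natl; apply: ideal_mull => //.
  have [ni|ni] := leqP n i; last first.
    by apply: ideal_mulr => //; apply: QX Qa; rewrite -addnBA ?leq_addr // ltnW.
  apply: ideal_mull => //; rewrite exprNn; apply: ideal_mull => //; exact: QX Qb.
- by exists m; rewrite exprMn; exact: ideal_mull.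
Qed.

Lemma det_mod_ideal Q n (A B : 'M[R]_n) : ideal Q ->
  (forall i j, Q (A i j - B i j)) -> Q (\det A - \det B).
Proof.
move=> hQ AB; case: (hQ) => _ hA _.
rewrite /determinant -sumrB; apply: asub_sum => // p _; rewrite -mulrBr; apply: ideal_mull => //.
elim/big_rec2: _ => [|i x y _ h]; first by rewrite subrr; exact: ideal_zero.
have -> (u v w z : R) : u * w - v * z = (u - v) * w + v * (w - z) by ring.
by apply: ideal_add => //; [exact: ideal_mulr|exact: ideal_mull].
Qed.

Lemma noetherian_noeth : noetherian R -> @noeth R setT.
Proof.
move=> nR I idI; have [s sI] := nR I idI; exists s; split=> [c cs|].
  by rewrite sI; apply: sub_ideal_gen.
rewrite {1}sI; apply: ideal_gen_le => [|c cs]; last by apply: sub_lspan.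
have hs := @lspan_submod R setT R^o [set` s].
apply: ideal_mk; first exact: (submod0 hs).
  by move=> a b; exact: (submodB hs).
by move=> a b; exact: (submodZ hs (a := a)).
Qed.

End Ideals.

(** * Torsion with respect to R_+ and J *)

Section StandardGraded.
Variables (R : comNzRingType) (G : nat -> set R) (s : seq R).
Hypothesis hG : is_grading G.
Hypothesis s1 : forall x, x \in s -> G 1%N x.
Hypothesis s_gen : smallest (@subring R) (G 0%N `|` [set` s]) = setT.

Lemma subring_setT : subring (setT : set R). Proof. by []. Qed.

Lemma grade0_subring : subring (G 0%N).
Proof. by split; [exact: grade_sub|exact: grade01|move=> x y; exact: gradeM]. Qed.

Lemma rpart_homM m a b k : G m a ->
  rpart hG (a * b) k = if (m <= k)%N then a * rpart hG b (k - m) else 0.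
Proof.
move=> Ga; move: b; apply: (ring_ind hG) => [n b Gb|b b' eb eb'|]; last 2 first.
- by rewrite mulrDr !rpartD eb eb'; case: ifP; rewrite ?addr0 ?mulrDr.
- by rewrite mulr0 !rpart0 mulr0 if_same.
have Gab := gradeM hG Ga Gb.
have [ek|nk] := eqVneq k (m + n)%N.
  by rewrite ek leq_addr addKn !rpart_id.
rewrite (rpart_neq hG Gab nk); case: leqP => // mk.
rewrite (rpart_neq hG Gb) ?mulr0 //.
by apply: contra nk => /eqP <-; rewrite subnKC.
Qed.

Lemma rpart_bigsum (L : Type) (r : seq L) (P : pred L) (F : L -> R) k :
  rpart hG (\sum_(l <- r | P l) F l) k = \sum_(l <- r | P l) rpart hG (F l) k.
Proof. exact: ds_comp_bigsum. Qed.

(** The elements whose degree [k] part lies in the [k]-th power for all [k] form a subring; it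
    contains [R_0] and the degree 1 generators, hence everything. *)
Lemma grade_sub_pow k : G k `<=` ideal_pow (ideal_gen [set` s]) k.
Proof.
set I := ideal_gen _.
pose T := [set a | forall k, ideal_pow I k (rpart hG a k)].
suff TT : T = setT.
  move=> a Ga; have : T a by rewrite TT.
  by move=> /(_ k); rewrite rpart_id.
have hT : subring T.
  have hI n := ideal_pow_ideal I n.
  split; first split.
  - by move=> n; rewrite rpart0; exact: (ideal_zero (hI n)).
  - by move=> a b Ta Tb n; rewrite rpartB; exact: (ideal_sub (hI n)).
  - case=> [//|n]; rewrite (rpart_neq hG (grade01 hG)) //; exact: (ideal_zero (hI n.+1)).
  - move=> a b Ta Tb n; have [sa [_ _ ->]] := rpart_sum hG a.
    rewrite mulr_suml rpart_bigsum; apply: asub_sum => [|i _]; first by case: (hI n).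
    rewrite (rpart_homM _ _ (rpart_in hG a i)); case: ifP => [/subnKC {1}<-|_].
      exact: ideal_powM.
    exact: (ideal_zero (hI n)).
apply/seteqP; split=> // a _.
have : smallest (@subring R) (G 0%N `|` [set` s]) a by rewrite s_gen.
apply; split=> // x [G0x|/= xs] n.
  have [->//|n0] := eqVneq n 0%N.
  by rewrite (rpart_neq hG G0x n0); exact: (ideal_zero (ideal_pow_ideal I n)).
have [->|n1] := eqVneq n 1%N.
  rewrite rpart_id; last exact: s1.
  by rewrite -[x]mulr1; apply: ideal_powS => //; exact: sub_ideal_gen.
by rewrite (rpart_neq hG (s1 xs) n1); exact: (ideal_zero (ideal_pow_ideal I n)).
Qed.

Lemma irrelevant_sub : irrelevant G `<=` ideal_gen [set` s].
Proof.
have hI := ideal_gen_ideal [set` s].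
move=> _ [N [f [fG ->]]]; apply: asub_sum_seq; first by case: hI.
move=> k; rewrite mem_index_iota => /andP[k0 _].
have := grade_sub_pow (fG k); case: k k0 => // k _.
by apply: ideal_powS_le => // a b Ia _; exact: (ideal_mulr _ hI).
Qed.

Lemma gen_irrelevant y : y \in s -> irrelevant G y.
Proof.
move=> /s1 Gy; exists 2%N, (fun n => if n == 1%N then y else 0); split.
  by move=> n; case: eqP => [->|_] //; exact: asub0 (grade_sub hG n).
by rewrite big_nat1.
Qed.

Section Torsion.
Variable J : set R.
Hypothesis idJ : ideal_in setT J.

(** The [a] with [a x] in [J x] form an ideal, so powers of the finitely many generators already
    yield the uniform exponent of the definition. *)
Lemma torsionP (V : lmodType R) (x : V) : torsion (irrelevant G) J x <->
  forall y, y \in s -> exists e b, J b /\ y ^+ e *: x = b *: x.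
Proof.
split=> [[n hn] y ys|h].
  have [//||b Jb e] := hn n _ (y ^+ n); last by exists n, b.
  by apply: ideal_pow_exp; exact: gen_irrelevant.
pose Q := [set a | exists b, J b /\ a *: x = b *: x].
have hQ : ideal_in setT Q.
  apply: ideal_mk => [|a a' [b [Jb e]] [b' [Jb' e']]|a b [c [Jc e]]].
  - by exists 0; split=> //; exact: ideal_zero.
  - by exists (b - b'); rewrite !scalerBl e e'; split=> //; exact: ideal_sub.
  - by exists (a * c); rewrite -!scalerA e; split=> //; exact: ideal_mull.
have [m hm] := ideal_pow_sub_of_gens hQ h.
exists m => n mn a Ia.
have [b [Jb e]] : Q a.
  by apply: hm; apply: (ideal_pow_anti mn); exact: (ideal_pow_mono irrelevant_sub).
by exists b.
Qed.

Lemma torsion_submod (V : lmodType R) : submod setT (@torsion R (irrelevant G) J V).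
Proof.
split; first split.
- apply/torsionP => y ys; exists 0%N, 0; rewrite !scaler0; split=> //; exact: ideal_zero.
- move=> x z /torsionP hx /torsionP hz; apply/torsionP => y ys.
  have [e [b [Jb eb]]] := hx y ys; have [f [c [Jc fc]]] := hz y ys.
  exists (e + f)%N, (y ^+ e * c + b * y ^+ f - b * c); split.
    apply: ideal_sub => //; last exact: ideal_mull.
    by apply: ideal_add => //; [exact: ideal_mull|exact: ideal_mulr].
  (* [(y^e - b) (y^f - c)] kills both [x] and [z] *)
  have kx : (y ^+ e - b) *: x = 0 by rewrite scalerBl eb subrr.
  have kz : (y ^+ f - c) *: z = 0 by rewrite scalerBl fc subrr.
  apply/eqP; rewrite -subr_eq0 -scalerBl.
  have -> : y ^+ (e + f) - (y ^+ e * c + b * y ^+ f - b * c) = (y ^+ f - c) * (y ^+ e - b).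
    by rewrite exprD; ring.
  rewrite scalerBr -[X in X - _]scalerA kx scaler0 mulrC -scalerA kz scaler0 subr0 //.
- move=> a x _ /torsionP hx; apply/torsionP => y /hx[e [b [Jb eb]]].
  by exists e, b; rewrite !(scalerA _ a) ![_ * a]mulrC -!scalerA eb.
Qed.

Hypothesis homJ : forall a k, J a -> J (rpart hG a k).

(* If [c = y^e - b] kills [x], the homogeneous components [x_p] of [x] are
   solutions of a square linear system whose matrix is congruent to the scalar
   matrix [y^e] modulo [J]; so its determinant, congruent to a power of [y],
   kills every [x_p]. *)
Lemma torsion_gpart (M : gmod G) (x : M) n :
  torsion (irrelevant G) J x -> torsion (irrelevant G) J (gpart x n).
Proof.
move=> /torsionP hx; apply/torsionP => y ys.
have [e [b [Jb eb]]] := hx y ys.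
have [r [ur rx xE]] := gpart_sum x.
have [nr|/rx ->] := boolP (n \in r); last first.
  by exists 0%N, 0; rewrite !scaler0; split=> //; exact: ideal_zero.
pose N := size r; pose p (i : 'I_N) := nth 0 r i.
pose c := y ^+ e - b.
have cx : c *: x = 0 by rewrite scalerBl eb subrr.
(* Row [i] expresses that [c x = 0] in degree [p i + e]. The offset [e], the degree of [y^e], puts
   [y^e] on the diagonal. *)
pose D := \matrix_(i < N, j < N) rpartz hG c (p i + e%:Z - p j).
have DE i : \sum_j D i j *: gpart x (p j) = 0.
  transitivity (gpart (c *: x) (p i + e%:Z)); last by rewrite cx gpart0.
  rewrite [in RHS]xE [in RHS](big_nth 0) big_mkord scaler_sumr.
  rewrite gpart_bigsum; apply: eq_bigr => j _; rewrite mxE.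
  by rewrite (@gpart_scale_hom _ _ hG M c _ (p j) _ (gpart_in x (p j))).
have detD j : \det D *: gpart x (p j) = 0.
  have := mul_adj_mx D => /matrixP/(_ j) adjE.
  transitivity (\sum_k (\adj D *m D) j k *: gpart x (p k)).
    rewrite (bigD1 j) //= adjE mxE eqxx big1 ?addr0 ?mulr1n // => k kj.
    by rewrite adjE mxE eq_sym (negbTE kj) mulr0n scale0r.
  transitivity (\sum_k \adj D j k *: \sum_l D k l *: gpart x (p l)).
    under [RHS]eq_bigr => k _ do rewrite scaler_sumr.
    rewrite exchange_big /=; apply: eq_bigr => l _; rewrite mxE scaler_suml.
    by apply: eq_bigr => k _; rewrite scalerA.
  by apply: big1 => k _; rewrite DE scaler0.
have Gye : G e (y ^+ e) by have := gradeX hG e (s1 ys); rewrite muln1.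
have cJ d : d != e%:Z -> J (rpartz hG c d).
  case: d => [k|k] /= ke; last exact: ideal_zero.
  by rewrite rpartB (rpart_neq hG Gye) // sub0r -(sub0r (rpart _ _ _)); apply: ideal_sub => //;
    [exact: ideal_zero|exact: homJ].
have detJ : J (\det D - y ^+ e ^+ N).
  rewrite -det_scalar; apply: det_mod_ideal => // i j; rewrite !mxE.
  have [->|ij] := eqVneq i j.
    rewrite mulr1n [p j + _]addrC addrK /= rpartB rpart_id // addrC addKr.
    by rewrite -(sub0r (rpart _ _ _)); apply: ideal_sub => //; [exact: ideal_zero|exact: homJ].
  rewrite mulr0n subr0; apply: cJ; rewrite addrAC -subr_eq0 addrK subr_eq0.
  by rewrite nth_uniq.
have [j ->] : exists j, n = p j.
  have nN : (index n r < N)%N by rewrite index_mem.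
  by exists (Ordinal nN); rewrite /p /= nth_index.
exists (e * N)%N, (y ^+ (e * N) - \det D); split.
  by have := ideal_sub idJ (ideal_zero idJ) detJ; rewrite sub0r opprB exprM.
by rewrite scalerBl detD subr0.
Qed.
End Torsion.

Lemma ideal_gen0_homogeneous (J0 : set R) a k :
  J0 `<=` G 0%N -> ideal_gen J0 a -> ideal_gen J0 (rpart hG a k).
Proof.
move=> J0G; have hJ := ideal_gen_ideal J0.
suff : ideal_gen J0 `<=` [set a | forall k, ideal_gen J0 (rpart hG a k)] by move=> /(_ a) h /h.
apply: ideal_gen_le => [|c Jc n].
  apply: ideal_mk => [n|c d hc hd n|c d hd n].
  - by rewrite rpart0; exact: (ideal_zero hJ).
  - by rewrite rpartB; exact: (ideal_sub hJ).
  - have [sa [_ _ ->]] := rpart_sum hG c.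
    rewrite mulr_suml rpart_bigsum; apply: asub_sum => [|i _]; first by case: hJ.
    rewrite (rpart_homM _ _ (rpart_in hG c i)); case: ifP => _; last exact: (ideal_zero hJ).
    exact: (ideal_mull _ hJ).
have [->|n0] := eqVneq n 0%N.
  by rewrite rpart_id; [exact: sub_ideal_gen|exact: J0G].
by rewrite (rpart_neq hG (J0G _ Jc) n0); exact: (ideal_zero hJ).
Qed.

(** * Finiteness of the base ring and of graded components *)

Section Noetherian.
Hypothesis noethR : noetherian R.

(** [R_0] is a retract of [R]: generators of the extended ideal project onto generators of the
    original one. *)
Lemma noeth_grade0 : @noeth R (G 0%N).
Proof.
move=> I0 [I0G hI0 I0M].
have [t tE] := noethR (ideal_gen_ideal I0).
have zero_part : ideal_gen I0 `<=` [set a | I0 (rpart hG a 0)].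
  apply: ideal_gen_le => [|a I0a]; last by rewrite /= rpart_id //; exact: I0G.
  apply: ideal_mk => /= [|a b ha hb|a b hb].
  - by rewrite rpart0; exact: asub0.
  - by rewrite rpartB; exact: asubB.
  - by rewrite rpartM0; apply: I0M => //; exact: rpart_in.
exists (map (fun a => rpart hG a 0%N) t); split=> [_ /mapP[c ct ->]|x I0x].
  by apply: zero_part; rewrite tE; exact: sub_ideal_gen.
set A := [set` _]; have hA := @lspan_submod R (G 0%N) R^o A.
have : ideal_gen I0 x by exact: sub_ideal_gen.
rewrite tE => tx.
suff : lspan (G 0%N) A (rpart hG x 0 : R^o) by rewrite rpart_id //; exact: I0G.
apply: (tx [set a | lspan (G 0%N) A (rpart hG a 0 : R^o)]); split=> [|c ct /=].
  apply: ideal_mk => /= [|a b ha hb|a b hb].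
  - by rewrite rpart0; exact: (submod0 hA).
  - by rewrite rpartB; exact: (submodB hA).
  - by rewrite rpartM0; apply: (submodZ hA) => //; exact: rpart_in.
by apply: sub_lspan; rewrite /A /=; exact: (map_f (fun a => rpart hG a 0%N)).
Qed.

Lemma fin_genP (M : lmodType R) : fin_gen M <-> fg_mod setT (setT : set M) [set 0].
Proof. exact: subquot_fgP subring_setT _ _ _. Qed.

Lemma submod_set0 (V : lmodType R) (S : set R) : submod S ([set 0] : set V).
Proof.
split; first by split=> // _ _ -> ->; rewrite subrr.
by move=> a _ _ ->; rewrite scaler0.
Qed.

Lemma fin_gen_sub (K M : lmodType R) (phi : {linear K -> M}) :
  injective phi -> fin_gen M -> fin_gen K.
Proof.
move=> iphi /fin_genP fM; apply/fin_genP.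
apply: (fg_exact subring_setT (noetherian_noeth noethR) (Z1 := [set 0]) (B1 := [set 0])
  (al := idfun) (be := phi) _ _ _ _ _ _ _ _ fM) => //; try exact: submod_set0.
- by move=> z _ /= e; exists 0 => //; rewrite /= subr0; apply: iphi; rewrite e linear0.
- exists [::]; split=> // z ->; exists 0; last by rewrite subr0.
  exact: (submod0 (lspan_submod _ _)).
Qed.

Lemma fin_gen_quot (M N : lmodType R) (pi : {linear M -> N}) :
  (forall y, exists x, y = pi x) -> fin_gen M -> fin_gen N.
Proof.
move=> spi /fin_genP fM; apply/fin_genP.
apply: (fg_exact subring_setT (noetherian_noeth noethR) (Z3 := setT) (B3 := setT)
  (al := pi) (be := idfun) _ _ _ _ _ _ _ fM) => //; try exact: submod_set0.
- by move=> _ ->; rewrite linear0.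
- by move=> z _ _; have [x ->] := spi z; exists x => //=; rewrite subrr.
- exists [::]; split=> // z _; exists 0 => //; exact: (submod0 (lspan_submod _ _)).
Qed.

(** The truncation of [M] to degrees at least [n] is a submodule, hence finitely generated over [R];
    the degree [n] parts of its generators span [M_n] over [R_0]. *)
Lemma gcomp_fg (M : gmod G) n : fin_gen M -> fg_mod (G 0%N) (gcomp M n) [set 0].
Proof.
move=> /fin_genP[t [_ tP]].
pose Z := [set x : M | forall k, k < n -> gpart x k = 0].
have hZ : submod setT Z.
  split; first split=> [k _|x y hx hy k kn]; first exact: gpart0.
    by rewrite gpartB hx // hy // subrr.
  by move=> a x _ hx k kn; exact: (gpart_lower hG _ hx).
have [u [uZ uP]] : fg_mod setT Z [set 0].
  apply: (fg_sub subring_setT (noetherian_noeth noethR) (s := t)) => //.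
    exact: submod_set0.
  by move=> z _; exact: tP.
exists (map (fun x : M => gpart x n) u); split=> [_ /mapP[x _ ->]|z Mz].
  exact: gpart_in.
exists z; last by rewrite subrr.
set A := [set` _]; have hA := lspan_submod (G 0%N) A.
have [|w uw /eqP] := uP z; first by move=> k kn; rewrite (gpart_neq Mz) // lt_eqF.
rewrite subr_eq0 => /eqP zw; rewrite -(gpart_id Mz) zw.
have : [set x : M | Z x /\ lspan (G 0%N) A (gpart x n)] w; last by case.
move: w uw {zw}; apply: lspan_le => [|x xu /=]; last first.
  by split; [exact: uZ|apply: sub_lspan; rewrite /A /=; exact: (map_f (fun x : M => gpart x n))].
split; first split.
- by split; [exact: (submod0 hZ)|rewrite gpart0; exact: (submod0 hA)].
- move=> x y [Zx sx] [Zy sy]; split; first exact: (submodB hZ).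
  by rewrite gpartB; exact: (submodB hA).
- move=> a x _ [Zx sx]; split; first exact: (submodZ hZ).
  by rewrite (gpart_lowest hG) //; apply: (submodZ hA) => //; exact: rpart_in.
Qed.
End Noetherian.

Definition nilpotent_on (M : lmodType R) (y : R) := exists e, forall x : M, y ^+ e *: x = 0.

(** Some power [m] of [R_+] kills [M]. If the generators live in degrees at most [c0], anything
    above [c0 + m] has coefficients of degree at least [m], which act as zero. *)
Lemma fin_gen_bounded_above (M : gmod G) : fin_gen M ->
  (forall y, y \in s -> nilpotent_on M y) -> exists c, bounded_above M c.
Proof.
move=> /fin_genP[t [_ tP]] nilM.
have [m hm] : exists m, ideal_pow (ideal_gen [set` s]) m `<=` [set a | forall x : M, a *: x = 0].
  apply: ideal_pow_sub_of_gens => //.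
  apply: ideal_mk => /= [x|a b ha hb x|a b hb x]; first by rewrite scale0r.
    by rewrite scalerBl ha hb subrr.
  by rewrite -scalerA hb scaler0.
have [c0 hc0] : exists c0 : int, forall g, g \in t -> forall n, c0 < n -> gpart g n = 0.
  elim: t {tP} => [|g t [c hc]]; first by exists 0.
  have [r hr] := gpart_supp g.
  have [d hd] : exists d : int, forall n, n \in r -> n <= d.
    elim: r {hr} => [|p r [d hd]]; first by exists 0.
    exists (Num.max p d) => n; rewrite inE => /predU1P[->|/hd nd]; rewrite le_max ?lexx //.
    by rewrite nd orbT.
  exists (Num.max c d) => h; rewrite inE => /predU1P[->|ht] n; rewrite gt_max => /andP[cn dn].
    by apply: hr; apply/negP => /hd; rewrite leNgt dn.
  exact: hc cn.
exists (c0 + m%:Z) => n cn x Mx.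
have [//|w tw /eqP] := tP x; rewrite subr_eq0 => /eqP xw.
suff /(_ 1 n cn) : [set x : M | forall a n, c0 + m%:Z < n -> gpart (a *: x) n = 0] x.
  by rewrite scale1r gpart_id.
rewrite xw; move: w tw {xw}; apply: lspan_le => [|g gt /= a k ck].
  split; first split=> [a k _|z w hz hw a k ck]; first by rewrite scaler0 gpart0.
    by rewrite scalerBr gpartB hz // hw // subrr.
  by move=> b z _ hz a k ck; rewrite scalerA; exact: hz.
move: a; apply: (ring_ind hG) => [d a Ga|a b ha hb|]; last 2 first.
- by rewrite scalerDl gpartD ha hb addr0.
- by rewrite scale0r gpart0.
have [md|dm] := leqP m d.
  have := hm a (ideal_pow_anti md (grade_sub_pow Ga)) => /= ->; exact: gpart0.
rewrite (gpartZ' _ _ Ga) hc0 ?scaler0 // ltrBrDr (le_lt_trans _ ck) // lerD2l.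
by rewrite lez_nat ltnW.
Qed.
End StandardGraded.

(** * Graded injective modules *)

Section QmodZ.

(** [zmodule rat] is the rationals as a module over the integers, so that [quotlmod] can form
    Q/Z. *)
Let ints : set (zmodule rat) := [set x | exists n : int, (x : rat) = n%:~R].

Lemma ints_submod : submod setT ints.
Proof.
split; first split.
- by exists 0.
- by move=> _ _ [m ->] [n ->]; exists (m - n); rewrite rmorphB.
- move=> a _ _ [n ->]; exists (n * a).
  by rewrite -[LHS]/((n%:~R : rat) *~ a) intrM mulrzr.
Qed.

Definition QmodZ : zmodType := quotlmod ints_submod.

Lemma QmodZ_divisible (q : QmodZ) (k : nat) : (0 < k)%N -> exists p : QmodZ, p *~ k = q.
Proof.
move=> k0; have [x ->] := quot_proj_surj q.
exists (quot_proj ints_submod ((x : rat) / k%:R : rat)).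
rewrite -pmulrn -raddfMn; congr (quot_proj _ _).
by rewrite -[LHS]/(((x : rat) / k%:R) *+ k) -mulr_natr divfK // pnatr_eq0 -lt0n.
Qed.

Lemma QmodZ_torsion (k : nat) : k != 1%N -> exists p : QmodZ, p != 0 /\ p *~ k = 0.
Proof.
(* For [k = 0] the second condition is void, and the class found for 2 serves. This case handles
   elements of infinite order. *)
move=> k1; wlog k2 : k k1 / (1 < k)%N => [h|].
  have [k2|] := ltnP 1 k; first exact: h.
  rewrite leq_eqVlt (negbTE k1) ltnS leqn0 => /eqP ->.
  by have [//|//|p [p0 _]] := h 2%N; exists p; rewrite mulr0z.
have k0 : k%:R != 0 :> rat by rewrite pnatr_eq0 -lt0n ltnW.
exists (quot_proj ints_submod (k%:R^-1 : rat)); split.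
  apply/negP => /eqP/(quot_proj_eq0 ints_submod)[n e].
  have := congr1 (fun x : rat => x * k%:R) e; rewrite mulVf // => /esym.
  rewrite -[k%:R]/(k%:Z%:~R) -intrM => /eqP; rewrite -[1]/(1%:~R) eqr_int => /eqP nk.
  have := congr1 absz nk; rewrite abszM /= => /eqP; rewrite muln_eq1 => /andP[_ /eqP e1].
  by rewrite e1 in k2.
rewrite -pmulrn -raddfMn; apply/(quot_proj_eq0 ints_submod); exists 1.
by rewrite -[LHS]/((k%:R^-1 : rat) *+ k) -(mulr_natr (k%:R^-1 : rat)) mulVf.
Qed.

Lemma int_subgroup (A : set int) : add_subgroup A ->
  exists k : nat, A k /\ forall m, A m -> exists q : int, m = q * k.
Proof.
move=> hA.
have AM m (q : int) : A m -> A (q * m).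
  move=> Am; have An n : A (n%:Z * m).
    elim: n => [|n IH]; first by rewrite mul0r; exact: (asub0 hA).
    by rewrite intS mulrDl mul1r; exact: (asubD hA).
  by case: q => n; [exact: An|rewrite NegzE mulNr; apply: (asubN hA); exact: An].
have [[k [k0 Ak]]|noA] := pselect (exists k : nat, (0 < k)%N /\ A k); last first.
  exists 0%N; split=> [|m Am]; first exact: (asub0 hA).
  exists 0; rewrite mul0r; apply: contrapT => /eqP m0; apply: noA.
  exists `|m|%N; rewrite absz_gt0; split=> //.
  by rewrite abszEsg; exact: AM.
have exk : exists k : nat, (0 < k)%N && `[< A k >].
  by exists k; rewrite k0; apply/asboolP.
case: (ex_minnP exk) => n /andP[n0 /asboolP An] minn; exists n; split=> // m Am.
exists (m %/ n%:Z)%Z; rewrite {1}(divz_eq m n).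
suff -> : (m %% n%:Z)%Z = 0 by rewrite addr0.
have Ar : A (m %% n%:Z)%Z by rewrite /modz; apply: asubB => //; exact: AM.
have r0 : 0 <= (m %% n%:Z)%Z by apply: modz_ge0; rewrite eqz_nat -lt0n.
have rn : (m %% n%:Z)%Z < n by apply: ltz_pmod; rewrite ltz_nat.
case er : (m %% n%:Z)%Z r0 rn Ar => [r|//] _; rewrite ltz_nat => rn Ar.
congr Posz; apply/eqP; rewrite -leqn0 leqNgt; apply/negP => rpos.
by have := minn r; rewrite rpos leqNgt rn; move=> /(_ (asboolT Ar)).
Qed.

Variable V : zmodType.

Lemma asub_mulz (W : zmodType) (A : set W) x (m : int) : add_subgroup A -> A x -> A (x *~ m).
Proof.
move=> hA Ax; have An n : A (x *+ n).
  by elim: n => [|n IH]; rewrite ?mulrS; [exact: asub0|exact: asubD].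
by case: m => n; [exact: An|apply: asubN => //; exact: An].
Qed.

Lemma pair_mulz (x : V) (t : QmodZ) (m : int) : (x, t) *~ m = (x *~ m, t *~ m).
Proof.
have h n : (x, t) *+ n = (x *+ n, t *+ n) by elim: n => // n IH; rewrite !mulrS IH.
by case: m => n; [exact: h|rewrite /intmul h].
Qed.

(* A functional subgroup of [V * Q/Z] is the graph of a homomorphism defined on
   a subgroup of [V]; a maximal one is total because [Q/Z] is divisible. *)
Lemma QmodZ_extend (gr0 : set (V * QmodZ)) :
  add_subgroup gr0 -> (forall t, gr0 (0, t) -> t = 0) ->
  exists g : V -> QmodZ, (forall x y, g (x - y) = g x - g y) /\
    forall x t, gr0 (x, t) -> g x = t.
Proof.
move=> hgr0 fun0.
have [|||gr [[hgr grf] gr0gr maxgr]] := @Zorn_above (V * QmodZ)%type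
    (fun gr => add_subgroup gr /\ forall t, gr (0, t) -> t = 0) gr0 => //.
- by exists 0; exact: asub0.
- move=> F [X FX] FP totF; split; last by move=> t [Y /FP[_ hY]]; exact: hY.
  split; first by exists X => //; apply: asub0; case: (FP X FX).
  move=> x y [Y FY Yx] [Z FZ Zy]; have [YZ|ZY] := totF Y Z FY FZ.
    by exists Z => //; have [hZ _] := FP Z FZ; apply: (asubB hZ) => //; exact: YZ.
  by exists Y => //; have [hY _] := FP Y FY; apply: (asubB hY) => //; exact: ZY.
have uniqgr x t t' : gr (x, t) -> gr (x, t') -> t = t'.
  move=> h h'; apply/eqP; rewrite -subr_eq0; apply/eqP/grf.
  by rewrite -(subrr x); exact: (asubB hgr h h').
have total v : exists t, gr (v, t).
  have hA : add_subgroup [set m : int | exists t, gr (v *~ m, t)].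
    split=> [|m n [t ht] [u hu]]; first by exists 0; rewrite mulr0z; exact: (asub0 hgr).
    by exists (t - u); rewrite mulrzBr; exact: (asubB hgr ht hu).
  have [k [[t0 ht0] kA]] := int_subgroup hA.
  (* The multiples of [v] in the domain are those of [k v], so a value [p] at [v] is consistent as
     soon as [k p] is the value [t0] at [k v]. *)
  have [p pk] : exists p : QmodZ, p *~ k = t0.
    case: k ht0 {kA} => [|k] ht0; last exact: QmodZ_divisible.
    by exists 0; rewrite mulr0z; apply/esym/grf; rewrite mulr0z in ht0.
  have pP (m : int) t : gr (v *~ m, t) -> t = p *~ m.
    move=> h; have [q mq] : exists q : int, m = q * k by apply: kA; exists t.
    apply: (uniqgr _ _ _ h); rewrite mq mulrC !mulrzA pk.
    by have := asub_mulz q hgr ht0; rewrite pair_mulz.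
  pose gr' := [set z | exists x t (m : int), gr (x, t) /\ z = (x + v *~ m, t + p *~ m)].
  have gr'gr : gr' `<=` gr.
    apply: maxgr; last by move=> [x t] h; exists x, t, 0; rewrite !mulr0z !addr0.
    split; first split.
    - by exists 0, 0, 0; rewrite !mulr0z !addr0; split=> //; exact: (asub0 hgr).
    - move=> _ _ [x [t [m [h ->]]]] [y [u [n [h' ->]]]]; exists (x - y), (t - u), (m - n).
      split; first exact: (asubB hgr h h').
      by rewrite !mulrzBr; congr pair; rewrite /= opprD addrACA.
    - move=> w [x [t [m [h [/esym/eqP xm ->]]]]]; move: xm; rewrite addr_eq0 => /eqP xm.
      by rewrite xm -mulrNz in h; rewrite (pP _ _ h) mulrNz addNr.
  by exists p; apply: gr'gr; exists 0, 0, 1; rewrite !mulr1z !add0r; split=> //; exact: (asub0 hgr).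
have /choice[g gP] := total.
exists g; split=> [x y|x t h]; last by apply: (uniqgr x) => //; exact: gr0gr.
by apply: (uniqgr (x - y)) => //; exact: (asubB hgr (gP x) (gP y)).
Qed.

(** Map the cyclic group of [x] to Q/Z by sending [x] to a nonzero class killed by its order, and
    extend. *)
Lemma QmodZ_separates (x : V) : exists g : V -> QmodZ,
  (forall y z, g (y - z) = g y - g z) /\ (x != 0 -> g x != 0).
Proof.
have [->|x0] := eqVneq x 0.
  by exists (fun=> 0); split=> [y z|]; [rewrite subrr|].
have hA : add_subgroup [set m : int | x *~ m = 0].
  by split=> [|m n /= xm xn]; rewrite /= ?mulr0z // mulrzBr xm xn subrr.
have [k [xk kA]] := int_subgroup hA.
have [|p [p0 pk]] := @QmodZ_torsion k.
  by apply: contraNneq x0 => k1; rewrite -(mulr1z x) -[1]/(1%N%:Z) -k1; exact/eqP.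
have [||g [gB gE]] := @QmodZ_extend [set z | exists m : int, z = (x *~ m, p *~ m)].
- split; first by exists 0.
  by move=> _ _ [m ->] [n ->]; exists (m - n); rewrite !mulrzBr.
- move=> t [m [/esym xm ->]]; have [q ->] := kA m xm.
  by rewrite mulrC mulrzA pk mul0rz.
by exists g; split=> // _; rewrite (gE x p) //; exists 1.
Qed.
End QmodZ.

(** * Coinduced graded modules *)

Section Coinduced.
Variables (R : comNzRingType) (X : Type) (L : set int).

(* The coinduced module [Hom_Z(R, D)], where [D] is the graded abelian group with
   [D_j = (Q/Z)^X] for [j] in [L] and [D_j = 0] otherwise. *)
Record coind := Coind {
  coind_val :> R -> int -> X -> QmodZ;
  coindB : forall r r' j x, coind_val (r - r') j x = coind_val r j x - coind_val r' j x;
  coind_out : forall r j x, ~ L j -> coind_val r j x = 0 }.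

Lemma coind_inj (e f : coind) : (forall r j x, e r j x = f r j x) -> e = f.
Proof.
case: e => e eB eL; case: f => f fB fL /= ef.
have {}ef : e = f by apply: funext => r; apply: funext => j; apply: funext => x.
by subst f; rewrite (Prop_irrelevance eB fB) (Prop_irrelevance eL fL).
Qed.

Lemma coind0 (e : coind) j x : e 0 j x = 0.
Proof. by have := coindB e 0 0 j x; rewrite !subrr. Qed.
Lemma coindN (e : coind) r j x : e (- r) j x = - e r j x.
Proof. by rewrite -(sub0r r) coindB coind0 sub0r. Qed.
Lemma coindD (e : coind) r r' j x : e (r + r') j x = e r j x + e r' j x.
Proof. by rewrite -{1}(opprK r') coindB coindN opprK. Qed.

HB.instance Definition _ := gen_eqMixin coind.
HB.instance Definition _ := gen_choiceMixin coind.

Definition coind_zero : coind.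
Proof. by exists (fun _ _ _ => 0) => // r r' j x; rewrite subrr. Defined.
Definition coind_opp (e : coind) : coind.
Proof.
exists (fun r j x => - e r j x) => [r r' j x|r j x nL] /=; first by rewrite coindB opprD.
by rewrite coind_out // oppr0.
Defined.
Definition coind_add (e f : coind) : coind.
Proof.
exists (fun r j x => e r j x + f r j x) => [r r' j x|r j x nL] /=.
  by rewrite !coindB opprD addrACA.
by rewrite !coind_out // addr0.
Defined.
Definition coind_scale (a : R) (e : coind) : coind.
Proof.
exists (fun r j x => e (r * a) j x) => [r r' j x|r j x nL] /=; last exact: coind_out.
by rewrite mulrBl coindB.
Defined.

Let addA : associative coind_add.
Proof. by move=> e f g; apply: coind_inj => r j x /=; rewrite addrA. Qed.
Let addC : commutative coind_add.
Proof. by move=> e f; apply: coind_inj => r j x /=; rewrite addrC. Qed.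
Let add0 : left_id coind_zero coind_add.
Proof. by move=> e; apply: coind_inj => r j x /=; rewrite add0r. Qed.
Let addN : left_inverse coind_zero coind_opp coind_add.
Proof. by move=> e; apply: coind_inj => r j x /=; rewrite addNr. Qed.
HB.instance Definition _ := GRing.isZmodule.Build coind addA addC add0 addN.

Let scaleA a b e : coind_scale a (coind_scale b e) = coind_scale (a * b) e.
Proof. by apply: coind_inj => r j x /=; rewrite mulrA. Qed.
Let scale1 : left_id 1 coind_scale.
Proof. by move=> e; apply: coind_inj => r j x /=; rewrite mulr1. Qed.
Let scaleDr : right_distributive coind_scale +%R.
Proof. by move=> a e f; apply: coind_inj. Qed.
Let scaleDl e : {morph coind_scale^~ e : a b / a + b}.
Proof. by move=> a b; apply: coind_inj => r j x /=; rewrite mulrDr coindD. Qed.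
HB.instance Definition _ :=
  GRing.Zmodule_isLmodule.Build R coind scaleA scale1 scaleDr scaleDl.

Variables (G : nat -> set R) (hG : is_grading G).

(** Homogeneous of degree [n] means mapping [R_k] to [D_(n+k)]; so the value in [D_j] is computed
    from the part of [r] of degree [j - n]. *)
Definition coind_proj (n : int) (e : coind) : coind.
Proof.
exists (fun r j x => e (rpartz hG r (j - n)) j x) => [r r' j x|r j x nL] /=.
  by rewrite rpartzB coindB.
exact: coind_out.
Defined.

Let projB n e f : coind_proj n (e - f) = coind_proj n e - coind_proj n f.
Proof. by apply: coind_inj. Qed.
Let proj0 n : coind_proj n 0 = 0.
Proof. by apply: coind_inj. Qed.
Let projK m n e : coind_proj m (coind_proj n e) = if m == n then coind_proj n e else 0.
Proof.
apply: coind_inj => r j x /=; rewrite rpartzK (inj_eq (addrI j)) (inj_eq oppr_inj) eq_sym.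
by case: eqP => [->//|_]; rewrite coind0.
Qed.
Let projZ m n a e : G m a -> coind_proj n (a *: e) = a *: coind_proj (n - m%:Z) e.
Proof.
move=> Ga; apply: coind_inj => r j x /=; congr (e _ j x); move: r.
have h k (r : R) : G k r -> rpartz hG r (j - n) * a = rpartz hG (r * a) (j - (n - m%:Z)).
  move=> Gr; have Gra := gradeM hG Gr Ga.
  have [e1|ne] := eqVneq (j - n) k%:Z.
    have -> : j - (n - m%:Z) = (k + m)%N%:Z by rewrite opprB addrA addrAC e1.
    by rewrite e1 !rpartz_id.
  rewrite (rpartz_neq hG Gr ne) mul0r (rpartz_neq hG Gra) //.
  apply: contra ne => /eqP e1; apply/eqP/(addIr m%:Z).
  by rewrite -PoszD -e1 opprB addrA addrAC.
apply: (ring_ind hG) => [k r|r r' hr hr'|]; first exact: h.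
  by rewrite mulrDl !rpartzD mulrDl hr hr'.
by rewrite mul0r !rpartz0 mul0r.
Qed.

(** A homomorphism may have infinitely many nonzero homogeneous parts; the graded coinduced module
    keeps those with finitely many. *)
Definition coind_fin : set coind := [set e | exists s : seq int, forall n, n \notin s -> coind_proj n e = 0].

Lemma coind_fin_submod : submod setT coind_fin.
Proof.
have finD e f : coind_fin e -> coind_fin f -> coind_fin (e - f).
  move=> [s hs] [t ht]; exists (s ++ t) => n; rewrite mem_cat negb_or => /andP[ns nt].
  by rewrite projB hs // ht // subrr.
have fin0 : coind_fin 0 by exists [::] => n _; exact: proj0.
split=> // a e _ [s hs]; move: a; apply: (ring_ind hG) => [m a Ga|a a' ha ha'|].
- exists (map (fun n => n + m%:Z) s) => n ns; rewrite (projZ _ _ Ga) hs ?scaler0 //.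
  by apply: contra ns => ns; apply/mapP; exists (n - m%:Z); rewrite // subrK.
- by rewrite scalerDl -(opprK (a' *: e)) -(sub0r (a' *: e)); apply: (finD) => //; exact: finD.
- by rewrite scale0r.
Qed.

Lemma coind_fin_proj n e : coind_fin (coind_proj n e).
Proof. by exists [:: n] => m; rewrite inE => mn; rewrite projK (negbTE mn). Qed.

Let cofree_ds : is_direct_sum
  (fun n => [set w : sublmod coind_fin_submod | coind_proj n (sublmod_val w) = sublmod_val w]).
Proof.
pose p n (w : sublmod coind_fin_submod) :=
  SubLmod coind_fin_submod (coind_fin_proj n (sublmod_val w)).
apply: (@is_direct_sum_proj _ _ _ p) => /=.
- by move=> n; split=> [|e f /= he hf]; rewrite /= ?proj0 // projB he hf.
- by move=> n w; rewrite projK eqxx.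
- by move=> n v w; apply: sublmod_inj; rewrite /= projB.
- by move=> n w h; apply: sublmod_inj.
- by move=> n m w h mn; apply: sublmod_inj; rewrite /= -h projK (negbTE mn).
- by move=> [w [s hs]]; exists s => n /hs e; apply: sublmod_inj.
- move=> w hw; apply: sublmod_inj; apply: coind_inj => r j x /=.
  move: r; apply: (ring_ind hG) => [k r Gr|r r' h h'|].
  + have /(congr1 (fun e : coind => e r j x))/= := congr1 (@sublmod_val _ _ _ _) (hw (j - k%:Z)).
    by rewrite opprB addrC subrK (rpartz_id hG Gr).
  + by rewrite coindD h h' addr0.
  + exact: coind0.
Qed.

Let cofree_scale m n a (w : sublmod coind_fin_submod) : G m a ->
  coind_proj n (sublmod_val w) = sublmod_val w ->
  coind_proj (m%:Z + n) (sublmod_val (a *: w)) = sublmod_val (a *: w).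
Proof. by move=> Ga h; rewrite /= (projZ _ _ Ga) addrC addKr h. Qed.

Definition cofree : gmod G := GMod cofree_ds cofree_scale.
Definition cofree_val (e : cofree) : coind := sublmod_val e.

Lemma cofree_gpart1 (e : cofree) j x :
  cofree_val (gpart e j) 1 j x = cofree_val e 1 j x.
Proof.
have G1 := grade01 hG.
move: e; apply: gmod_ind => [n e he|e f ee ef|]; last 2 first.
- by rewrite gpartD; exact: (congr2 +%R ee ef).
- by rewrite gpart0.
have [->|jn] := eqVneq j n; first by rewrite gpart_id.
rewrite (gpart_neq he jn) /cofree_val -[in RHS](he : coind_proj n _ = _) /=.
rewrite (rpartz_neq hG G1) ?coind0 //.
by rewrite subr_eq0.
Qed.

(** The coinduction adjunction: additive maps [B_j -> D_j] induce the homogeneous map sending [b] to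
    [r |-> psi (r b)]. *)
Lemma cofree_map (B : gmod G) (psi : int -> X -> B -> QmodZ) :
  (forall j x b b', psi j x (b - b') = psi j x b - psi j x b') ->
  (forall j x b, ~ L j -> psi j x b = 0) ->
  exists g : {linear B -> cofree}, homogeneous0 g /\
    forall b r j x, cofree_val (g b) r j x = psi j x (gpart (r *: b) j).
Proof.
move=> psiB psiL.
have psi0 j x : psi j x 0 = 0 by have := psiB j x 0 0; rewrite !subrr.
have psiD j x b b' : psi j x (b + b') = psi j x b + psi j x b'.
  by rewrite -{1}(opprK b') -(sub0r b') !psiB psi0 sub0r opprK.
have hadd b r r' j x : psi j x (gpart ((r - r') *: b) j) =
    psi j x (gpart (r *: b) j) - psi j x (gpart (r' *: b) j).
  by rewrite scalerBl gpartB psiB.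
pose f b : coind := @Coind (fun r j x => psi j x (gpart (r *: b) j)) (hadd b)
  (fun r j x => psiL j x _).
have fproj n q b : gcomp B q b -> coind_proj n (f b) = if n == q then f b else 0.
  move=> Bb; apply: coind_inj => r j x /=; rewrite !(gpart_scale_hom hG _ _ Bb) rpartzK.
  rewrite (inj_eq (addrI j)) (inj_eq oppr_inj) eq_sym.
  by case: eqP => [->|_]; rewrite /= ?(gpart_scale_hom hG _ _ Bb) // scale0r psi0.
have fD b b' : f (b + b') = f b + f b'.
  by apply: coind_inj => r j x /=; rewrite scalerDr gpartD psiD.
have ffin b : coind_fin (f b).
  move: b; apply: gmod_ind => [q b Bb|b b' hb hb'|].
  - by exists [:: q] => n; rewrite inE => nq; rewrite (fproj _ _ _ Bb) (negbTE nq).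
  - by rewrite fD; exact: (submodD coind_fin_submod).
  - exists [::] => n _; apply: coind_inj => r j x /=.
    by rewrite scaler0 gpart0 psi0.
have [|g gE] := @linear_mk R B cofree (fun b => SubLmod coind_fin_submod (ffin b)).
  move=> a b b'; apply: sublmod_inj => /=; rewrite fD; congr +%R.
  by apply: coind_inj => r j x /=; rewrite scalerA.
exists g; split=> [q b Bb|b r j x]; last by rewrite gE.
by rewrite gE /= (fproj _ _ _ Bb) eqxx.
Qed.

(** By adjunction, extending a map into [cofree] amounts to extending Q/Z-valued characters from the
    subgroups [u (A_j)] to [B]. *)
Lemma cofree_injective : graded_injective cofree.
Proof.
move=> A B u f hu iu hf.
have ext j x : exists psi : B -> QmodZ, [/\ forall b b', psi (b - b') = psi b - psi b',
    ~ L j -> forall b, psi b = 0 &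
    forall a, gcomp A j a -> psi (u a) = cofree_val (f a) 1 j x].
  have [Lj|nL] := pselect (L j); last first.
    exists (fun=> 0); split=> // [b b'|a _]; first by rewrite subrr.
    by rewrite coind_out.
  have [||psi [psiB psiE]] := @QmodZ_extend B [set z | exists a,
      gcomp A j a /\ z = (u a, cofree_val (f a) 1 j x)].
  - split; first by exists 0; rewrite !linear0; split=> //; exact: gcomp0.
    move=> _ _ [a [ha ->]] [a' [ha' ->]]; exists (a - a'); split; first exact: gcompB.
    by rewrite !linearB.
  - by move=> t [a [_ [/esym]]]; rewrite -(linear0 u) => /iu -> ->; rewrite linear0.
  exists psi; split=> // a ha; apply: psiE; by exists a.
have /choice[psi psiP] : forall jx : int * X, exists psi : B -> QmodZ,
   [/\ forall b b', psi (b - b') = psi b - psi b', ~ L jx.1 -> forall b, psi b = 0 &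
    forall a, gcomp A jx.1 a -> psi (u a) = cofree_val (f a) 1 jx.1 jx.2].
  by move=> [j x]; exact: ext.
have [||g [hg gE]] := @cofree_map B (fun j x => psi (j, x)).
- by move=> j x; case: (psiP (j, x)).
- by move=> j x b nL; case: (psiP (j, x)) => _ /(_ nL).
exists g; split=> // a; apply: sublmod_inj; apply: coind_inj => r j x.
rewrite -[LHS]/(cofree_val (g (u a)) r j x) gE -linearZ_LR -homogeneous0_gpart //.
case: (psiP (j, x)) => _ _ -> /=; last exact: gpart_in.
rewrite (homogeneous0_gpart _ _ hf) cofree_gpart1 (linearZ_LR f).
by rewrite /cofree_val /= mul1r.
Qed.

(** An element of degree [n] sends [R_k] to [D_(n+k)] with [k >= 0], and [D] vanishes above [c]. *)
Lemma cofree_bounded c : (forall j, L j -> j <= c) ->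
  forall n, c < n -> forall e, gcomp cofree n e -> e = 0.
Proof.
move=> Lc n cn e he; apply: sublmod_inj; apply: coind_inj => r j x /=.
have [Lj|nL] := pselect (L j); last by rewrite coind_out.
rewrite -(he : coind_proj n _ = _) /=.
case ejn : (j - n) => [k|k]; last by rewrite /= coind0.
suff : n <= c by rewrite leNgt cn.
by rewrite (le_trans _ (Lc j Lj)) // -subr_ge0 ejn.
Qed.

End Coinduced.

(** * Injective resolutions that preserve upper bounds *)

Section Resolution.
Variables (R : comNzRingType) (G : nat -> set R) (hG : is_grading G).

(** One copy of Q/Z is used for each element [x] of [M], with a character not vanishing at [x],
    which makes the map injective; restricting to the degrees in which [M] is nonzero preserves
    upper bounds. *)
Lemma enough_graded_injectives (M : gmod G) : exists (E : gmod G) (f : {linear M -> E}),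
  [/\ graded_injective E, homogeneous0 f, injective f &
      forall c, bounded_above M c -> bounded_above E c].
Proof.
pose L : set int := [set j | exists2 m, gcomp M j m & m <> 0].
have /choice[chi chiP] := @QmodZ_separates M.
pose psi (j : int) (x : M) (b : M) : QmodZ := if `[< L j >] then chi x b else 0.
have [||f [hf fE]] := @cofree_map R M L G hG M psi.
- by move=> j x b b'; rewrite /psi; case: asboolP; rewrite ?subr0 //; case: (chiP x).
- by move=> j x b nL; rewrite /psi asboolF.
exists (cofree M L hG), f; split=> //; first exact: cofree_injective.
- move=> x y fxy; apply/eqP; rewrite -subr_eq0; apply: contrapT => /negP xy0.
  have [j xyj] : exists j, gpart (x - y) j <> 0.
    apply: contrapT => h; move/eqP: xy0; apply; apply: gpart_inj => j; rewrite gpart0.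
    by apply: contrapT => hj; apply: h; exists j.
  have Lj : L j by exists (gpart (x - y) j) => //; exact: gpart_in.
  have := fE (x - y) 1 j (gpart (x - y) j); rewrite linearB fxy subrr scale1r /psi asboolT //.
  case: (chiP (gpart (x - y) j)) => _ /(_ (introN eqP xyj)) /eqP + e.
  by move=> h; apply: h; rewrite -e.
- move=> c bM; apply: cofree_bounded => j [m Mm m0]; rewrite leNgt; apply/negP => cj.
  by apply: m0; exact: bM cj _ Mm.
Qed.

Lemma enough_resolutions (M : gmod G) : exists E : graded_injective_resolution M,
  forall c, bounded_above M c -> forall i, bounded_above (res_obj E i) c.
Proof.
have /choice[Q QP] := enough_graded_injectives.
pose f M0 := sval (cid (QP M0)).
have fP M0 : [/\ graded_injective (Q M0), homogeneous0 (f M0), injective (f M0) &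
    forall c, bounded_above M0 c -> bounded_above (Q M0) c] := svalP (cid (QP M0)).
pose im M := [set x : Q M | exists y, x = f M y].
have him M0 : submod setT (im M0).
  split; first split; first by exists 0; rewrite linear0.
    by move=> _ _ [x ->] [y ->]; exists (x - y); rewrite linearB.
  by move=> a _ _ [x ->]; exists (a *: x); rewrite linearZ.
have hhom M0 : homogeneous_set (im M0).
  by move=> _ n [x ->]; exists (gpart x n); rewrite homogeneous0_gpart //; case: (fP M0).
pose C M := quotg (him M) (hhom M).
pose pr M : {linear Q M -> C M} := quotg_proj (him M) (hhom M).
pose Mi i := iter i C M.
pose d i : {linear Q (Mi i) -> Q (Mi i.+1)} := f (Mi i.+1) \o pr (Mi i).
have hd i : homogeneous0 (d i).
  move=> n x Qx; case: (fP (Mi i.+1)) => _ hf _ _; apply: hf; exact: quotg_proj_hom.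
have d0 i x : d i x = 0 <-> exists y, x = f (Mi i) y.
  have [_ _ inf _] := fP (Mi i.+1).
  have e := quotg_proj_eq0 (him (Mi i)) (hhom (Mi i)) x; split=> [dx|/e prx].
    by apply/e/inf; rewrite linear0.
  by rewrite /d /= [quot_proj _ _]prx linear0.
have dS i x : d i.+1 x = 0 <-> exists y, x = d i y.
  rewrite d0; split=> [[y ->]|[y ->]]; last by exists (pr (Mi i) y).
  by have [z ->] := quotg_proj_surj y; exists z.
have [injM homM infM _] := fP M.
have injQ i : graded_injective (Q (Mi i)) by case: (fP (Mi i)).
exists (@GradedInjectiveResolution R G M (fun i => Q (Mi i)) (f M) d injQ homM hd infM (d0 0%N) dS).
move=> c bM i /=; case: (fP (Mi i)) => _ _ _; apply.
elim: i => [//|i IH] n cn _ [x Qx ->].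
have [_ _ _ bQ] := fP (Mi i).
by rewrite (bQ c IH n cn x Qx) linear0.
Qed.
End Resolution.

(** * Devissage *)

Section Devissage.
Variables (R : comNzRingType) (G : nat -> set R).
Hypotheses (hG : is_grading G) (noethR : noetherian R).

Lemma nilpotent_on_sub (K M : lmodType R) (phi : {linear K -> M}) y :
  injective phi -> nilpotent_on M y -> nilpotent_on K y.
Proof. by move=> iphi [e he]; exists e => x; apply: iphi; rewrite linearZ_LR he linear0. Qed.

Lemma nilpotent_on_quot (M N : lmodType R) (pi : {linear M -> N}) y :
  (forall z, exists x, z = pi x) -> nilpotent_on M y -> nilpotent_on N y.
Proof.
by move=> spi [e he]; exists e => z; have [x ->] := spi z; rewrite -linearZ_LR he linear0.
Qed.

Lemma nilpotent_on_fg (M : lmodType R) y : fin_gen M ->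
  (forall x : M, exists e, y ^+ e *: x = 0) -> nilpotent_on M y.
Proof.
move=> /fin_genP[t [_ tP]] nil.
have [e he] : exists e, forall g, g \in t -> y ^+ e *: g = 0.
  elim: t {tP} => [|g t [e he]]; first by exists 0%N.
  have [f hf] := nil g; exists (e + f)%N => h; rewrite inE => /predU1P[->|ht].
    by rewrite exprD -scalerA hf scaler0.
  by rewrite addnC exprD -scalerA he // scaler0.
exists e => x; have [//|w tw /eqP] := tP x; rewrite subr_eq0 => /eqP ->.
apply: (lspan_le (W := [set x : M | y ^+ e *: x = 0])) tw => //.
split; first split=> [|u v hu hv]; rewrite /= ?scaler0 //.
  by rewrite scalerBr hu hv subrr.
by move=> a u _ hu /=; rewrite scalerA mulrC -scalerA hu scaler0.
Qed.

Lemma scale_gpart_gradeX (M : gmod G) y d e (x : M) n : G d y ->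
  y ^+ e *: gpart x n = gpart (y ^+ e *: x) ((e * d)%N%:Z + n).
Proof. by move=> Gy; rewrite (gpartZ _ _ (gradeX hG e Gy)). Qed.

(* One element [y] of [t] at a time: [y] is nilpotent on the submodule [K] of
   elements killed by a power of [y], and regular on [M / K]. *)
Lemma graded_devissage (t : seq R) (P : gmod G -> Prop) :
  (forall y, y \in t -> exists d, G d y) ->
  (forall M : gmod G, fin_gen M -> (forall y, y \in t -> nilpotent_on M y) -> P M) ->
  (forall (K M N : gmod G) (phi : {linear K -> M}) (pi : {linear M -> N}),
     homogeneous0 phi -> homogeneous0 pi -> injective phi ->
     (forall z, exists x, z = pi x) -> (forall x, pi x = 0 <-> exists k, x = phi k) ->
     P K -> P N -> P M) ->
  (forall y (N Q : gmod G) (pi : {linear N -> Q}), y \in t -> fin_gen N ->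
     (forall x : N, y *: x = 0 -> x = 0) -> homogeneous0 pi ->
     (forall z, exists x, z = pi x) -> (forall x, pi x = 0 <-> exists z, x = y *: z) ->
     P Q -> P N) ->
  forall M : gmod G, fin_gen M -> P M.
Proof.
move=> homt base ext step.
(* [u] lists the elements not yet known to be nilpotent on the module. Removing [y] from [u] is
   possible for [K] and for [Q], and [step] passes from [Q] to [N]. *)
suff claim (u : seq R) : {subset u <= t} -> forall M : gmod G, fin_gen M ->
    (forall y, y \in t -> y \notin u -> nilpotent_on M y) -> P M.
  by move=> M fM; apply: (claim t) => // y ->.
elim: u => [|y u IH] ut M fM nilM; first by apply: base => // y yt; exact: nilM.
have {}IH := IH (fun z zu => ut z (mem_behead (s := y :: u) zu)).
have yt : y \in t by apply: ut; rewrite inE eqxx.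
have [d Gy] := homt y yt.
pose W := [set x : M | exists e, y ^+ e *: x = 0].
have hW : submod setT W.
  split; first split.
  - by exists 0%N; rewrite scaler0.
  - move=> x z [e he] [f hf]; exists (e + f)%N; rewrite scalerBr.
    by rewrite exprD -[in X in _ - X]scalerA hf scaler0 mulrC -scalerA he scaler0 subrr.
  - by move=> a x _ [e he]; exists e; rewrite scalerA mulrC -scalerA he scaler0.
have homW : homogeneous_set W.
  by move=> x n [e he]; exists e; rewrite (scale_gpart_gradeX _ _ _ Gy) he gpart0.
pose K := subg hW homW; pose N := quotg hW homW.
pose phi : {linear K -> M} := subg_incl hW homW.
pose pi : {linear M -> N} := quotg_proj hW homW.
have iphi : injective phi by exact: subg_incl_inj.
have spi : forall z, exists x, z = pi x by exact: quotg_proj_surj.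
have fK : fin_gen K by apply: (fin_gen_sub noethR iphi).
have fN : fin_gen N by apply: (fin_gen_quot noethR spi).
have nilK z : z \in t -> z \notin u -> nilpotent_on K z.
  move=> zt zu; have [->|zy] := eqVneq z y; last first.
    by apply: (nilpotent_on_sub iphi); apply: nilM => //; rewrite inE negb_or zy.
  apply: nilpotent_on_fg => // -[x [e he]]; exists e; exact: sublmod_inj.
have regN (x : N) : y *: x = 0 -> x = 0.
  have [z ->] := spi x; rewrite -linearZ_LR => /quotg_proj_eq0[e he].
  by apply/quotg_proj_eq0; exists e.+1; rewrite exprSr -scalerA.
pose W' := [set x : N | exists z, x = y *: z].
have hW' : submod setT W'.
  split; first split; first by exists 0; rewrite scaler0.
    by move=> _ _ [x ->] [z ->]; exists (x - z); rewrite scalerBr.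
  by move=> a _ _ [x ->]; exists (a *: x); rewrite !scalerA mulrC.
have homW' : homogeneous_set W'.
  by move=> _ n [x ->]; exists (gpart x (n - d%:Z)); rewrite (gpartZ' _ _ Gy).
pose Q := quotg hW' homW'; pose pi' : {linear N -> Q} := quotg_proj hW' homW'.
have spi' : forall z, exists x, z = pi' x by exact: quotg_proj_surj.
have fQ : fin_gen Q by apply: (fin_gen_quot noethR spi').
apply: (ext K M N phi pi) => //.
- exact: quotg_proj_hom.
- by move=> x; rewrite quotg_proj_eq0; exact: subg_inclP.
- exact: IH.
apply: (step y N Q pi') => //.
- exact: quotg_proj_hom.
- by move=> x; exact: quotg_proj_eq0.
apply: IH => // z zt zu; have [->|zy] := eqVneq z y; last first.
  by do 2! apply: nilpotent_on_quot => //; apply: nilM => //; rewrite inE negb_or zy.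
exists 1%N => q; have [x ->] := spi' q; rewrite -linearZ_LR; apply/quotg_proj_eq0.
by exists x.
Qed.
End Devissage.

(** * Graded components of local cohomology *)

Section Components.
Variables (R : comNzRingType) (G : nat -> set R) (s : seq R).
Hypotheses (hG : is_grading G) (noethR : noetherian R).
Hypothesis s1 : forall x, x \in s -> G 1%N x.
Hypothesis s_gen : smallest (@subring R) (G 0%N `|` [set` s]) = setT.
Variable J : set R.
Hypothesis idJ : ideal_in setT J.
Hypothesis homJ : forall a k, J a -> J (rpart hG a k).

Local Notation I := (irrelevant G).
Local Notation cocycles E i := (lc_cocycles I J E i).
Local Notation coboundaries E i := (lc_coboundaries I J E i).

Let tsub (A : gmod G) : submod setT (@torsion R I J A).
Proof. exact: (torsion_submod hG s1 s_gen idJ). Qed.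
Let tgpart (A : gmod G) (x : A) n : torsion I J x -> torsion I J (gpart x n).
Proof. exact: (torsion_gpart s1 s_gen idJ homJ). Qed.
Let cocS (M : gmod G) (E : graded_injective_resolution M) i : submod setT (cocycles E i).
Proof. exact: cocycles_submod. Qed.
Let cobS (M : gmod G) (E : graded_injective_resolution M) i : submod setT (coboundaries E i).
Proof. exact: coboundaries_submod. Qed.

(** Vanishing and finite generation are also stated for one resolution at a time, the form in which
    the exact sequence transports them. *)
Definition lc_van (M : gmod G) (E : graded_injective_resolution M) i n :=
  forall z, cocycles E i z -> gcomp (res_obj E i) n z -> coboundaries E i z.

Definition lc_fg (M : gmod G) (E : graded_injective_resolution M) i n :=
  fg_mod (G 0%N) (cocycles E i `&` gcomp (res_obj E i) n)
    (coboundaries E i `&` gcomp (res_obj E i) n).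

Lemma lc_vanishesP (M : gmod G) i n :
  lc_vanishes I J M i n <-> forall E : graded_injective_resolution M, lc_van E i n.
Proof.
split=> h E z; first by move=> cz hz; have [] := h E z (conj cz hz).
by move=> [cz hz]; split=> //; exact: h.
Qed.

Lemma lc_fin_genP (M : gmod G) i n :
  lc_fin_gen I J M i n <-> forall E : graded_injective_resolution M, lc_fg E i n.
Proof. by split=> h E; apply/(subquot_fgP (grade0_subring hG)); exact: h. Qed.

Let subm_gcomp (M : gmod G) (A : set M) n :
  submod setT A -> submod (G 0%N) (A `&` gcomp M n).
Proof.
move=> hA; split; first split.
- by split; [exact: (submod0 hA)|exact: gcomp0].
- by move=> x y [Ax hx] [Ay hy]; split; [exact: (submodB hA)|exact: gcompB].
- by move=> a x Ga [Ax hx]; split; [exact: (submodZ hA)|exact: gcompZ0].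
Qed.

Let cocG (M : gmod G) (E : graded_injective_resolution M) i n :
  submod (G 0%N) (cocycles E i `&` gcomp (res_obj E i) n).
Proof. exact: subm_gcomp. Qed.
Let cobG (M : gmod G) (E : graded_injective_resolution M) i n :
  submod (G 0%N) (coboundaries E i `&` gcomp (res_obj E i) n).
Proof. exact: subm_gcomp. Qed.

Let fg_of_sub (V : lmodType R) (Z B : set V) : Z `<=` B -> fg_mod (G 0%N) Z B.
Proof.
move=> ZB; exists [::]; split=> // z /ZB Bz; exists 0; last by rewrite subr0.
exact: (submod0 (lspan_submod _ _)).
Qed.

Lemma lc_van_fg (M : gmod G) (E : graded_injective_resolution M) i n :
  lc_van E i n -> lc_fg E i n.
Proof. by move=> h; apply: fg_of_sub => z [cz hz]; split=> //; exact: h. Qed.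

Lemma bounded_above_torsion (M : gmod G) c (x : M) : bounded_above M c -> torsion I J x.
Proof.
move=> bM; move: x; apply: gmod_ind => [n x Mx|x y tx ty|].
(* This exponent pushes an element of degree [n] beyond [c]; the element of [J] is 0. *)
- apply/(torsionP hG s1 s_gen idJ) => y ys; exists `|c - n|.+1%N, 0.
  split; first exact: ideal_zero.
  rewrite scale0r; apply: (bM (`|c - n|.+1%N%:Z + n)).
    by rewrite -ltrBlDr intS (le_lt_trans (ler_norm _)) // -abszE ltrDr.
  apply: gcomp_scale => //; have := gradeX hG `|c - n|.+1%N (s1 ys).
  by rewrite muln1.
- exact: (submodD (tsub M)).
- exact: (submod0 (tsub M)).
Qed.

(* A resolution by injectives vanishing above [c] consists of torsion modules. *)
Lemma bounded_above_lc (M : gmod G) c (E : graded_injective_resolution M) :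
  bounded_above M c ->
  (forall i n, lc_van E i.+1 n) /\ (forall i n, c < n -> lc_van E i n).
Proof.
move=> bM; have [E' /(_ c bM) bE'] := enough_resolutions hG M.
have [f fE] := chain_map_lift E E' (phi := idfun) (fun n x h => h).
have [g gE] := chain_map_lift E' E (phi := idfun) (fun n x h => h).
(* [g] after [f] is homotopic to the identity, so vanishing of a class may be tested in the bounded
   resolution [E']. *)
have back i z : cocycles E i z -> coboundaries E' i (f i z) -> coboundaries E i z.
  move=> cz /(cmap_coboundary g) h.
  have k : coboundaries E i (g i (f i z) - z).
    apply: (chain_map_homotopic (f := cmap_comp g f) (g := cmap_id E)) => // m.
    by rewrite /= fE gE.
  by have := submodB (cobS E i) h k; rewrite opprB addrC subrK.
split=> [i n z cz hz|i n cn z cz hz]; apply: back => //.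
  have [_ /res_exactS[y ->]] := cmap_cocycle f cz.
  by exists y => //; apply: (@bounded_above_torsion _ c); exact: bE'.
have -> : f i z = 0 by apply: (bE' i n cn); exact: cmap_hom.
exact: (submod0 (cobS E' i)).
Qed.

Section ShortExact.
Variables (K M N : gmod G) (phi : {linear K -> M}) (pi : {linear M -> N}).
Hypotheses (hphi : homogeneous0 phi) (hpi : homogeneous0 pi).
Hypotheses (iphi : injective phi) (spi : forall y, exists x, y = pi x).
Hypothesis exact_phi_pi : forall x, pi x = 0 <-> exists y, x = phi y.
Variables (EK : graded_injective_resolution K) (EM : graded_injective_resolution M)
  (EN : graded_injective_resolution N).

Lemma lc_van_mid i n : lc_van EK i n -> lc_van EN i n -> lc_van EM i n.
Proof.
move=> vK vN z cz hz.
have [F FE] := chain_map_lift EK EM hphi; have [P PE] := chain_map_lift EM EN hpi.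
have [|z' [cz' hz' Bz]] := lc_exact_mid tsub tgpart hphi iphi spi exact_phi_pi FE PE cz hz.
  by apply: vN; [exact: cmap_cocycle|exact: cmap_hom].
have := submodD (cobS EM i) Bz (cmap_coboundary F (vK _ cz' hz')).
by rewrite subrK.
Qed.

Lemma lc_fg_mid i n : lc_fg EK i n -> lc_fg EN i n -> lc_fg EM i n.
Proof.
have [F FE] := chain_map_lift EK EM hphi; have [P PE] := chain_map_lift EM EN hpi.
apply: (fg_exact (grade0_subring hG) (noeth_grade0 hG noethR) (al := F i) (be := P i)) => //.
- by move=> z [cz hz]; split; [exact: cmap_cocycle|exact: cmap_hom].
- by move=> z [cz hz]; split; [exact: cmap_coboundary|exact: cmap_hom].
- by move=> z [cz hz]; split; [exact: cmap_cocycle|exact: cmap_hom].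
- move=> z [cz hz] [Bz _].
  have [z' [cz' hz' Bz']] := lc_exact_mid tsub tgpart hphi iphi spi exact_phi_pi FE PE cz hz Bz.
  by exists z' => //; split=> //; apply: gcompB => //; exact: cmap_hom.
Qed.

Variable F : chain_map EK EM.
Hypothesis liftF : forall m, F 0%N (res_aug EK m) = res_aug EM (phi m).

(** The premise on [j] encodes [H^{i-1}(N)], read as zero for [i = 0], where [F] is injective on
    cocycles instead. *)
Lemma lc_fg_left i n :
  (forall j, i = j.+1 -> lc_fg EN j n) -> lc_fg EM i n -> lc_fg EK i n.
Proof.
have [P PE] := chain_map_lift EM EN hpi.
have FZ k z : (cocycles EK k `&` gcomp (res_obj EK k) n) z ->
    (cocycles EM k `&` gcomp (res_obj EM k) n) (F k z).
  by move=> [cz hz]; split; [exact: cmap_cocycle|exact: cmap_hom].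
case: i => [|i] fN fM.
  apply: (fg_exact (grade0_subring hG) (noeth_grade0 hG noethR) (Z1 := [set 0]) (B1 := [set 0])
    (al := idfun) (be := F 0%N) _ _ _ _ _ _ _ _ fM) => //.
  - by move=> z ->; exact: (submod0 (cocG EK 0 n)).
  - by move=> z ->; exact: (submod0 (cobG EK 0 n)).
  - exact: FZ.
  - move=> z [cz _] [/= Fz _]; exists 0 => //.
    rewrite (lc_mono0 iphi liftF cz Fz) subrr; exact: (submod0 (cobG EK 0 n)).
  - exact: fg_of_sub.
have [dl [hdl dlZ dlB dlE]] :=
  lc_connecting tsub tgpart hphi iphi spi exact_phi_pi liftF PE.
apply: (fg_exact (grade0_subring hG) (noeth_grade0 hG noethR)
  (al := dl i) (be := F i.+1) _ _ _ _ _ _ _ (fN i erefl) fM) => //.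
- by move=> z [cz hz]; split; [exact: dlZ|exact: hdl].
- by move=> z [cz hz]; split; [exact: dlB|exact: hdl].
- exact: FZ.
- move=> z [cz hz] [Fz _]; have [b [cb hb Bb]] := dlE i n z cz hz Fz.
  by exists b => //; split=> //; apply: gcompB => //; exact: hdl.
Qed.

Lemma lc_inj_left i n z : (forall j, i = j.+1 -> lc_van EN j n) ->
  cocycles EK i z -> gcomp (res_obj EK i) n z ->
  coboundaries EM i (F i z) -> coboundaries EK i z.
Proof.
have [P PE] := chain_map_lift EM EN hpi.
case: i z => [|i] z vN cz hz Fz; first exact: (lc_mono0 iphi liftF cz Fz).
have [dl [_ _ dlB dlE]] :=
  lc_connecting tsub tgpart hphi iphi spi exact_phi_pi liftF PE.
have [b [cb hb Bb]] := dlE i n z cz hz Fz.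
have := submodD (cobS EK i.+1) Bb (dlB i b (vN i erefl b cb hb)).
by rewrite subrK.
Qed.

Lemma lc_surj_left i n z : lc_van EN i n -> cocycles EM i z -> gcomp (res_obj EM i) n z ->
  exists z', [/\ cocycles EK i z', gcomp (res_obj EK i) n z' & coboundaries EM i (z - F i z')].
Proof.
move=> vN cz hz; have [P PE] := chain_map_lift EM EN hpi.
apply: (lc_exact_mid tsub tgpart hphi iphi spi exact_phi_pi liftF PE cz hz).
by apply: vN; [exact: cmap_cocycle|exact: cmap_hom].
Qed.
End ShortExact.

(** * Multiplication by a homogeneous element *)

Section Multiplication.
Variables (N : gmod G) (y : R) (d : nat) (Gy : G d y).

Lemma scale_linear (V : lmodType R) (a : R) : linear (fun x : V => a *: x).
Proof. by move=> b u v; rewrite scalerDr !scalerA mulrC. Qed.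

Definition scale_map : {linear shiftg N (- d%:Z) -> N} := linear_of (@scale_linear N y).

Lemma scale_map_hom : homogeneous0 scale_map.
Proof.
by move=> n x /= /(gcomp_scale Gy); rewrite addrC subrK.
Qed.

(** Multiplication by [y] on each object of [E] lifts multiplication on [N], so the map induced on
    cohomology is multiplication by [y]. *)
Definition scale_chain (E : graded_injective_resolution N) : chain_map (shift_res E (- d%:Z)) E.
Proof.
exists (fun i => linear_of (@scale_linear (res_obj E i) y)
  : {linear res_obj (shift_res E (- d%:Z)) i -> res_obj E i}).
- by move=> i n x /= /(gcomp_scale Gy); rewrite addrC subrK.
- by move=> i x /=; rewrite -linearZ_LR.
Defined.

Lemma scale_chain_aug (E : graded_injective_resolution N) (m : shiftg N (- d%:Z)) :
  scale_chain E 0%N (res_aug (shift_res E (- d%:Z)) m) = res_aug E (scale_map m).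
Proof. by rewrite /= -linearZ_LR. Qed.
End Multiplication.

Section ScaleExact.
Variables (N Q : gmod G) (pi : {linear N -> Q}) (y : R) (d : nat) (Gy : G d y).
Hypothesis reg : forall x : N, y *: x = 0 -> x = 0.
Hypothesis exact_pi : forall x, pi x = 0 <-> exists z : N, x = y *: z.

Lemma scale_map_inj : injective (scale_map N y d).
Proof.
move=> x x' /= e; apply/eqP; rewrite -subr_eq0; apply/eqP.
by apply: (reg (x := x - x')); rewrite scalerBr; apply/eqP; rewrite subr_eq0; apply/eqP.
Qed.

Lemma scale_map_exact x : pi x = 0 <-> exists z, x = scale_map N y d z.
Proof. exact: exact_pi. Qed.
End ScaleExact.

Lemma lc_fin_gen_of_vanishing :
  (forall M : gmod G, fin_gen M -> forall i, exists n0 : int, forall n, n0 <= n ->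
     lc_vanishes I J M i n) ->
  forall M : gmod G, fin_gen M -> forall i n, lc_fin_gen I J M i n.
Proof.
move=> hvan.
apply: (graded_devissage hG noethR (t := s) (P := fun M => forall i n, lc_fin_gen I J M i n)).
- by move=> y /s1 Gy; exists 1%N.
- move=> M fM nilM; have [c bM] := fin_gen_bounded_above hG s1 s_gen fM nilM.
  case=> [|i] n; apply/lc_fin_genP => E; last exact/lc_van_fg/(bounded_above_lc E bM).1.
  apply: (fg_exact (grade0_subring hG) (noeth_grade0 hG noethR) (al := res_aug E) (be := idfun)
    (Z3 := setT) (B3 := setT) _ _ _ _ _ _ _ (gcomp_fg hG noethR n fM)) => //.
  + move=> m hm; split; last exact: res_aug_homogeneous.
    split; last exact: res_diff_aug.
    apply: torsion_linear; exact: bounded_above_torsion bM.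
  + by move=> _ ->; rewrite linear0; exact: (submod0 (cobG E 0 n)).
  + move=> z [[_ /res_exact0[m zm]] hz] _; exists (gpart m n); first exact: gpart_in.
    rewrite homogeneous0_gpart; last exact: res_aug_homogeneous.
    by rewrite -zm gpart_id // subrr; exact: (submod0 (cobG E 0 n)).
  + exact: fg_of_sub.
- move=> K M N phi pi hphi hpi iphi spi expi PK PN i n; apply/lc_fin_genP => E.
  have [EK _] := enough_resolutions hG K; have [EN _] := enough_resolutions hG N.
  have fK : lc_fg EK i n by move/lc_fin_genP: (PK i n).
  have fN : lc_fg EN i n by move/lc_fin_genP: (PN i n).
  exact: (lc_fg_mid hphi hpi iphi spi expi E fK fN).
move=> y N Q pi ys fN reg hpi spi expi PQ i n; apply/lc_fin_genP => E.
have [EQ _] := enough_resolutions hG Q.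
have Gy := s1 ys; have [n0 hn0] := hvan N fN i.
(* Descending induction on the degree, with [k] bounding the distance to the range of vanishing. *)
have claim k (m : int) : n0 <= m + k%:Z -> lc_fg E i m.
  elim: k m => [|k IH] m.
    by rewrite addr0 => /hn0/lc_vanishesP/(_ E)/lc_van_fg.
  rewrite intS addrA => /IH fm.
  (* Degree [m + 1] of [N(-1)] is degree [m] of [N]; hence [Q] and [E] are taken in degree
     [m + 1]. *)
  have fQ j : i = j.+1 -> lc_fg EQ j (m + 1) by move/lc_fin_genP: (PQ j (m + 1)).
  have := lc_fg_left (scale_map_hom Gy) hpi (scale_map_inj (d := 1) reg) spi
    (scale_map_exact 1 expi) (scale_chain_aug Gy E) fQ fm.
  by rewrite /lc_fg /= addrK.
by apply: (claim `|n0 - n|%N); rewrite -lerBlDl abszE ler_norm.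
Qed.

(** * From finite generation to vanishing *)

Section Vanishing.
Variable t : seq R.
Hypotheses (t0 : forall x, x \in t -> G 0%N x) (Jt : J `<=` ideal_gen [set` t]).

(** Multiplication by [a] and by 0 both lift the zero map of [N], hence agree on cohomology. *)
Lemma annihilator_lc (N : gmod G) (E : graded_injective_resolution N) a i z :
  G 0%N a -> (forall x : N, a *: x = 0) -> cocycles E i z -> coboundaries E i (a *: z).
Proof.
move=> Ga aN cz; have G00 : G 0%N 0 by exact: asub0 (grade_sub hG 0).
have := chain_map_homotopic (f := scale_chain Ga E) (g := scale_chain G00 E) (I := I) (J := J) _
  (i := i) (z := z) cz.
rewrite /= scale0r subr0; apply=> m.
by rewrite /= scale0r -linearZ_LR aN linear0.
Qed.

Definition eventually_vanishing (M : gmod G) :=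
  forall i, exists n0 : int, forall n, n0 <= n -> lc_vanishes I J M i n.

Lemma eventually_vanishing_ext (K M N : gmod G) (phi : {linear K -> M}) (pi : {linear M -> N}) :
  homogeneous0 phi -> homogeneous0 pi -> injective phi ->
  (forall z, exists x, z = pi x) -> (forall x, pi x = 0 <-> exists k, x = phi k) ->
  eventually_vanishing K -> eventually_vanishing N -> eventually_vanishing M.
Proof.
move=> hphi hpi iphi spi expi PK PN i.
have [n1 h1] := PK i; have [n2 h2] := PN i; exists (Num.max n1 n2) => n.
rewrite ge_max => /andP[/h1/lc_vanishesP v1 /h2/lc_vanishesP v2]; apply/lc_vanishesP => E.
have [EK _] := enough_resolutions hG K; have [EN _] := enough_resolutions hG N.
exact: (lc_van_mid hphi hpi iphi spi expi (EM := E) (v1 EK) (v2 EN)).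
Qed.

Lemma eventually_vanishing_nilpotent (M : gmod G) : fin_gen M ->
  (forall x, x \in t -> nilpotent_on M x) -> eventually_vanishing M.
Proof.
move: M; apply: (graded_devissage hG noethR (t := s)
  (P := fun M => (forall x, x \in t -> nilpotent_on M x) -> eventually_vanishing M)).
- by move=> y /s1 Gy; exists 1%N.
- move=> M fM nilM _ i; have [c bM] := fin_gen_bounded_above hG s1 s_gen fM nilM.
  exists (c + 1) => n cn; apply/lc_vanishesP => E; apply: (bounded_above_lc E bM).2.
  by rewrite (lt_le_trans _ cn) // ltrDl.
- move=> K M N phi pi hphi hpi iphi spi expi PK PN nilM.
  apply: (eventually_vanishing_ext hphi hpi iphi spi expi).
    by apply: PK => x /nilM; exact: (nilpotent_on_sub iphi).
  by apply: PN => x /nilM; exact: (nilpotent_on_quot spi).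
move=> y N Q pi ys fN reg hpi spi expi PQ nilN i.
have {}PQ : eventually_vanishing Q by apply: PQ => x /nilN; exact: (nilpotent_on_quot spi).
have [EQ _] := enough_resolutions hG Q.
have Gy := s1 ys.
have [n0 hn0] : exists n0 : int, forall n, n0 <= n -> forall j, i = j.+1 -> lc_van EQ j n.
  case: i => [|i]; first by exists 0.
  have [n0 h] := PQ i; exists n0 => n /h/lc_vanishesP v j [<-]; exact: v.
exists n0 => n n0n; apply/lc_vanishesP => E z cz hz.
(* The kernel of [y] from degree [m] to degree [m + 1] comes from [H^{i-1}(Q)] in degree [m + 1],
   which vanishes. *)
have yinj m w : n0 <= m -> cocycles E i w -> gcomp (res_obj E i) m w ->
    coboundaries E i (y *: w) -> coboundaries E i w.
  move=> n0m cw hw yw.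
  have vQ j : i = j.+1 -> lc_van EQ j (m + 1) by apply: hn0; rewrite (le_trans n0m) // lerDl.
  apply: (lc_inj_left (scale_map_hom Gy) hpi (scale_map_inj (d := 1) reg) spi
    (scale_map_exact 1 expi) (scale_chain_aug Gy E) vQ cw) => //.
  by rewrite /= addrK.
have ypow k : coboundaries E i (y ^+ k *: z) -> coboundaries E i z.
  elim: k => [|k IH]; first by rewrite scale1r.
  rewrite exprS -scalerA => h; apply: IH; apply: (yinj (k%:Z + n)) h.
  - by rewrite (le_trans n0n) // lerDr.
  - exact: (submodZ (cocS E i)).
  - by apply: gcomp_scale => //; have := gradeX hG k Gy; rewrite muln1.
(* The annihilator of the class of [z]. It contains a power of each element of [t], so its radical
   contains [J]. *)
pose A := [set a | coboundaries E i (a *: z)].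
have hA : ideal_in setT A.
  apply: ideal_mk => [|a b ha hb|a b hb].
  - by rewrite /A /= scale0r; exact: (submod0 (cobS E i)).
  - by rewrite /A /= scalerBl; exact: (submodB (cobS E i)).
  - by rewrite /A /= -scalerA; exact: (submodZ (cobS E i)).
have [tz _] := cz.
have [e [b [Jb yb]]] := (torsionP hG s1 s_gen idJ z).1 tz y ys.
have [k Ak] : [set a | exists m, A (a ^+ m)] b.
  apply: (ideal_gen_le (radical_ideal hA)) (Jt Jb) => x xt.
  have [m hm] := nilN x xt; exists m; apply: annihilator_lc => //.
  by have := gradeX hG m (t0 xt); rewrite muln0.
(* On [z] itself [y^e] acts as [b], so [y^(e k)] acts as [b^k], which kills the class. *)
apply: (ypow (e * k)%N); rewrite exprM.
suff -> : y ^+ e ^+ k *: z = b ^+ k *: z by [].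
elim: k {Ak} => // k IH; rewrite exprS -scalerA IH scalerA mulrC -scalerA yb scalerA.
by rewrite -exprSr.
Qed.

Hypothesis tunit : forall x, x \in t -> forall c, G 0%N c ->
  G 0%N (x * c) /\ exists2 u, G 0%N u & u * (1 - x * c) = 1.

Lemma vanishing_of_lc_fin_gen :
  (forall M : gmod G, fin_gen M -> forall i n, lc_fin_gen I J M i n) ->
  forall M : gmod G, fin_gen M -> eventually_vanishing M.
Proof.
move=> hfg; apply: (graded_devissage hG noethR (t := t)).
- by move=> x /t0 Gx; exists 0%N.
- exact: eventually_vanishing_nilpotent.
- exact: eventually_vanishing_ext.
move=> x N Q pi xt fN reg hpi spi expi PQ i; have Gx := t0 xt.
have [EQ _] := enough_resolutions hG Q.
have [n0 h] := PQ i; exists n0 => n /h/lc_vanishesP vQ; apply/lc_vanishesP => E z cz hz.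
have fE : lc_fg E i n by move/lc_fin_genP: (hfg N fN i n).
have [] := nakayama (grade0_subring hG) (tunit xt) (cocG E i n) (cobG E i n) fE _ (conj cz hz).
  move=> {}z {cz hz} [cz hz].
  (* As [x] has degree 0, multiplication by [x] maps [H^i(N)_n] to itself, onto because
     [H^i(Q)_n = 0]; so the bound found for [Q] serves for [N]. *)
  have [z' [cz' hz' Bz]] := lc_surj_left (scale_map_hom Gx) hpi (scale_map_inj (d := 0) reg) spi
    (scale_map_exact 0 expi) (scale_chain_aug Gx E) (vQ EQ) cz hz.
  have hz'' : gcomp (res_obj E i) n z' by move: hz'; rewrite /= subr0.
  exists z'; first by [].
  by split=> //; apply: gcompB => //; exact: gcompZ0.
by [].
Qed.
End Vanishing.
End Components.

Theorem theorem3p3 (R : comNzRingType) (G : nat -> set R) (m0 J0 : set R)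
    (noethR : noetherian R) (stdG : standard_graded G)
    (locR0 : local_in (G 0%N) m0)
    (idJ0 : ideal_in (G 0%N) J0) (J0m0 : J0 `<=` m0) :
  (forall M : gmod G, fin_gen M -> forall i : nat,
     exists n0 : int, forall n : int, n0 <= n ->
       lc_vanishes (irrelevant G) (ideal_gen J0) M i n)
  <->
  (forall M : gmod G, fin_gen M -> forall (i : nat) (n : int),
     lc_fin_gen (irrelevant G) (ideal_gen J0) M i n).
Proof.
case: stdG => hG [s [s1 s_gen]].
have J0G : J0 `<=` G 0%N by case: idJ0.
have idJ := ideal_gen_ideal J0.
have homJ a k : ideal_gen J0 a -> ideal_gen J0 (rpart hG a k).
  exact: ideal_gen0_homogeneous.
split; first exact: (lc_fin_gen_of_vanishing noethR s1 s_gen idJ homJ).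
(* Generators of [J_0] over [R_0] also generate the extended ideal over [R]; having degree 0, they
   are admissible for the devissage. *)
have [t [tJ0 J0t]] := noeth_grade0 hG noethR idJ0.
have Jt : ideal_gen J0 `<=` ideal_gen [set` t].
  have ht := ideal_gen_ideal [set` t].
  apply: ideal_gen_le => // x /J0t; apply: (@lspan_le R (G 0%N) R^o).
    split; first by case: ht.
    by move=> a b _; exact: (ideal_mull a ht).
  by move=> y; exact: sub_ideal_gen.
apply: (vanishing_of_lc_fin_gen noethR s1 s_gen idJ homJ (t := t)) => // [x /tJ0/J0G//|x xt c Gc].
(* Multiples of [x] over [R_0] stay in [J_0], hence in [m0], which gives the units for Nakayama. *)
have Jxc : J0 (x * c) by case: idJ0 => _ _ JM; rewrite mulrC; apply: JM => //; exact: tJ0.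
split; first exact: J0G.
exact: (local_in_unit (grade0_subring hG) locR0 (J0m0 _ Jxc)).
Qed.
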